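(* Let $P\to M$ be a principal $G$-bundle, let $A$ be a connection on $P$, and let $E$ be either the space $\mathrm{L}M$ of free loops or the space $\mathrm{P}M$ of paths in $M$. Let $\Phi_A:\mathrm{ev}_0^*P\to\mathrm{ev}^*P$ be the isomorphism of principal bundles over $E\times\mathrm{I}$ associated to the parallel transport with respect to $A$. The condition that $\Phi_A\odot\Phi_A^{-1}$ intertwines the fibred product connections, i.e. $$(\Phi_A\odot\Phi_A^{-1})^*(\mathrm{ev}^*A\odot\mathrm{ev}_0^*A)=\mathrm{ev}_0^*A\odot\mathrm{ev}^*A,$$ is equivalent to the horizontality equation for the parallel transport $$d\,\mathrm{H}(A)|_0^{\bullet}+\mathrm{ev}^*A\;\mathrm{H}(A)|_0^{\bullet}-\mathrm{H}(A)|_0^{\bullet}\;\mathrm{ev}_0^*A=0$$ on $\mathrm{ev}_0^*P\odot\mathrm{ev}^*P$; that is, for every point $(\gamma;t;p,q)$ of $\mathrm{ev}_0^*P\odot\mathrm{ev}^*P$ and every tangent vector $X=(X_\gamma;X_t;X_p,X_q)$ there, writing $h=\mathrm{H}(A;\gamma;t;p,q)$, $$T_{(\gamma;t;p,q)}\mathrm{H}(A)|_0^{\bullet}(X)+T_eR_h\big(A_q(X_q)\big)-T_eL_h\big(A_p(X_p)\big)=0,$$ where $L_h,R_h$ are left and right multiplication by $h$ in $G$.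
   Context: $G$ is a Lie group with Lie algebra $\mathfrak{g}$, $M$ a connected paracompact manifold, $\pi:P\to M$ a principal $G$-bundle with right action; $\mathrm{I}=[0,1]$. A connection $A$ is a $\mathfrak{g}$-valued 1-form on $P$ with $R_g^*A=\mathrm{Ad}(g^{-1})A$ and $A_p(T_eL_p(\xi))=\xi$, where $L_p(g)=pg$. Curves (paths) are piecewise smooth maps $\mathrm{I}\to M$; loops satisfy $\gamma(0)=\gamma(1)$. $\mathrm{L}M,\mathrm{P}M$ are regarded as (infinite-dimensional) smooth manifolds with smooth evaluation maps. $\mathrm{ev},\mathrm{ev}_0:E\times\mathrm{I}\to M$ are $\mathrm{ev}(\gamma;t)=\gamma(t)$, $\mathrm{ev}_0(\gamma;t)=\gamma(0)$. Points of $\mathrm{ev}^*P$ (resp. $\mathrm{ev}_0^*P$) are triples $(\gamma;t;p)$ with $\pi(p)=\gamma(t)$ (resp. $\pi(p)=\gamma(0)$). $\mathrm{ev}^*A$ and $\mathrm{ev}_0^*A$ are the pull-backs of $A$ along $(\gamma;t;p)\mapsto p$; in the horizontality equation the same symbols denote their further pull-backs along the projections of $\mathrm{ev}_0^*P\odot\mathrm{ev}^*P$ onto its factors, and products denote the tangent maps of left and right multiplication. For $p\in P_{\gamma(0)}$, $q\in P_{\gamma(t)}$, $\mathrm{H}(A;\gamma;t;p,q)\in G$ is defined by $\widetilde\gamma_{A,p}(t)=q\,\mathrm{H}(A;\gamma;t;p,q)$, with $\widetilde\gamma_{A,p}$ the $A$-horizontal lift of $\gamma$ starting at $p$; $\mathrm{H}(A)|_0^\bullet:\mathrm{ev}_0^*P\odot\mathrm{ev}^*P\to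 G$ is the map $(\gamma;t;p,q)\mapsto\mathrm{H}(A;\gamma;t;p,q)$. $\Phi_A(\gamma;t;p)=(\gamma;t;q\,\mathrm{H}(A;\gamma;t;p,q))$ for any $q\in P_{\gamma(t)}$. For principal $G$-bundles $Q,\widetilde Q$ over the same base, $Q\odot\widetilde Q$ is the principal $G\times G$-bundle of pairs over the same base point; for connections $B,\widetilde B$ on them, $(B\odot\widetilde B)_{(q,\widetilde q)}(X_q,X_{\widetilde q})=(B_q(X_q),\widetilde B_{\widetilde q}(X_{\widetilde q}))$. For an isomorphism $\sigma:Q\to\widetilde Q$, $(\sigma\odot\sigma^{-1})(q,\widetilde q)=(\sigma(q),\sigma^{-1}(\widetilde q))\in\widetilde Q\odot Q$. *)

(* Defs.v *)
From HB Require Import structures.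
From mathcomp Require Import all_boot all_order all_algebra.
From mathcomp Require Import all_classical all_reals all_analysis.

Set Implicit Arguments.
Unset Strict Implicit.
Unset Printing Implicit Defensive.

Import Order.TTheory GRing.Theory Num.Theory.
Import numFieldNormedType.Exports.

Local Open Scope classical_set_scope.
Local Open Scope ring_scope.

Section SmoothMaps.
Context {R : realType}.

(* Meant for open U and finite-dimensional V. *)
Fixpoint Ck {V W : normedModType R} (k : nat) (U : set V) (f : V -> W) : Prop :=
  match k with
  | 0%N => forall x, U x -> {for x, continuous f}
  | k'.+1 => (forall x, U x -> differentiable f x) /\
             (forall v, Ck k' U ('D_v f))
  end.

Definition smooth_on {V W : normedModType R} (U : set V) (f : V -> W) : Prop :=
  forall k, Ck k U f.

Lemma differentiable_near_eq (V W : normedModType R) (f g : V -> W) (x : V) :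
  {near x, f =1 g} -> differentiable f x -> differentiable g x.
Proof.
move=> fg /diff_locallyP[dfc dfx].
have fgx : f x = g x by exact: (nbhs_singleton fg).
have fg0 : \forall h \near (0 : V), f (h + x) = g (h + x).
  by move: fg; rewrite (near_shift 0) subr0 /= => fg0; near=> h; near: h.
have E : g \o shift x = cst (g x) + 'd f x +o_ 0 id.
  apply/eqaddoP => e e0; move/eqaddoP: dfx => /(_ e e0).
  apply: filterS2 fg0 => h /= fgh.
  by rewrite !fctE /= fgh fgx.
have dE := diff_unique dfc E.
by apply/diff_locallyP; rewrite dE; split.
Unshelve. all: by end_near. Qed.

Lemma Ck_eq (V W : normedModType R) k (U : set V) (f g : V -> W) :
  open U -> (forall x, U x -> f x = g x) -> Ck k U f -> Ck k U g.
Proof.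
move=> oU; elim: k f g => [|k IH] f g fg /=.
  move=> cf x Ux; have nfg : {near x, f =1 g}.
    by apply: filterS (open_nbhs_nbhs (conj oU Ux)).
  have fgx := fg x Ux.
  rewrite /prop_for /continuous_at -fgx; apply: cvg_trans (cf x Ux).
  by apply: near_eq_cvg; apply: filterS nfg => y ->.
move=> [df Df]; split=> [x Ux|v].
  apply: differentiable_near_eq (df x Ux).
  by apply: filterS (open_nbhs_nbhs (conj oU Ux)).
apply: IH (Df v) => x Ux; apply: near_eq_derive.
by apply: filterS (open_nbhs_nbhs (conj oU Ux)).
Qed.

Lemma smooth_on_id (V : normedModType R) (U : set V) : smooth_on U id.
Proof.
have Ccst (W : normedModType R) k (c : W) : Ck k U (fun=> c).
  elim: k c => [|k IH] c /=; first by move=> x _; exact: cvg_cst.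
  split=> [x _|v]; first exact: differentiable_cst.
  by rewrite (_ : 'D_v _ = fun=> 0) //; apply/funext => x; exact: derive_cst.
case=> [|k] /=; first by move=> x _; exact: cvg_id.
split=> [x _|v]; first exact: ex_diff.
rewrite (_ : 'D_v _ = fun=> v); first exact: Ccst.
apply/funext => x; exact: derive_id.
Qed.

Lemma differentiable_fst (V W : normedModType R) (z : V * W) :
  differentiable (@fst V W) z.
Proof.
have flin : linear (@fst V W) by [].
pose fM := GRing.isLinear.Build _ _ _ _ _ flin.
pose fL : {linear _ -> _} := HB.pack (@fst V W) fM.
by apply: (@linear_differentiable _ _ _ fL) => a; exact: cvg_fst.
Qed.

Lemma differentiable_snd (V W : normedModType R) (z : V * W) :
  differentiable (@snd V W) z.
Proof.
have flin : linear (@snd V W) by [].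
pose fM := GRing.isLinear.Build _ _ _ _ _ flin.
pose fL : {linear _ -> _} := HB.pack (@snd V W) fM.
by apply: (@linear_differentiable _ _ _ fL) => a; exact: cvg_snd.
Qed.

Lemma smooth_on_prod (V V' W W' : normedModType R) (U : set V) (U' : set V')
    (f : V -> W) (g : V' -> W') : open U -> open U' ->
  smooth_on U f -> smooth_on U' g ->
  smooth_on (U `*` U') (fun z => (f z.1, g z.2)).
Proof.
move=> oU oU' sf sg k.
have oUU : open (U `*` U').
  rewrite openE => z [Uz U'z]; exists (U, U') => //.
  by split; apply: open_nbhs_nbhs.
have {sf} : Ck k U f by exact: sf.
have {sg} : Ck k U' g by exact: sg.
elim: k f g => [|k IH] f g /=.
  move=> cg cf z [Uz U'z]; apply: cvg_pair.
    by apply: (@cvg_comp _ _ _ fst f); [exact: cvg_fst|exact: cf].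
  by apply: (@cvg_comp _ _ _ snd g); [exact: cvg_snd|exact: cg].
move=> [dg Dg] [df Df].
have df1 z : U z.1 -> differentiable (f \o @fst V V') z.
  move=> Uz; apply: differentiable_comp; last exact: df.
  exact: differentiable_fst.
have dg1 z : U' z.2 -> differentiable (g \o @snd V V') z.
  move=> Uz; apply: differentiable_comp; last exact: dg.
  exact: differentiable_snd.
split=> [z [Uz U'z]|v].
  exact: (differentiable_pair (df1 z Uz) (dg1 z U'z)).
apply: (@Ck_eq _ _ _ _ (fun z => ('D_v.1 f z.1, 'D_v.2 g z.2))) => //;
  last exact: (IH _ _ (Dg v.2) (Df v.1)).
move=> z [Uz U'z].
have /cvg_ex[a fa] : derivable (f \o @fst V V') z v.
  exact/diff_derivable/df1.
have /cvg_ex[b gb] : derivable (g \o @snd V V') z v.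
  exact/diff_derivable/dg1.
have fE : 'D_v.1 f z.1 = a by exact: cvg_lim fa.
have gE : 'D_v.2 g z.2 = b by exact: cvg_lim gb.
rewrite fE gE; symmetry; apply: cvg_lim => //.
exact: cvg_pair fa gb.
Qed.

End SmoothMaps.

Section Manifolds.
Context {R : realType}.

Record chart (V : normedModType R) (T : topologicalType) := Chart {
  chart_dom : set T;
  chart_cod : set V;
  chart_coord : T -> V;
  chart_param : V -> T;
  chart_dom_open : open chart_dom;
  chart_cod_open : open chart_cod;
  coord_cod : forall x, chart_dom x -> chart_cod (chart_coord x);
  param_dom : forall v, chart_cod v -> chart_dom (chart_param v);
  chart_coordK : forall x, chart_dom x -> chart_param (chart_coord x) = x;
  chart_paramK : forall v, chart_cod v -> chart_coord (chart_param v) = v;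
  coord_continuous : forall x, chart_dom x -> {for x, continuous chart_coord};
  param_continuous : forall v, chart_cod v -> {for v, continuous chart_param}
}.

(* A smooth Hausdorff manifold modelled on V, given by an atlas indexed by the
   points: [mchart x] is a preferred chart around x.  Every atlas can be
   reindexed in this way.  The tangent space at x is V, read in the preferred
   chart at x; all tangent vectors and tangent maps below follow this
   convention. *)
Record manifold (V : normedModType R) := Manifold {
  mcarrier :> topologicalType;
  mchart : mcarrier -> chart V mcarrier;
  mchart_dom : forall x, chart_dom (mchart x) x;
  mchart_compat : forall x y,
    smooth_on
      (chart_cod (mchart x) `&`
         chart_param (mchart x) @^-1` chart_dom (mchart y))
      (chart_coord (mchart y) \o chart_param (mchart x));
  manifold_hausdorff : hausdorff_space mcarrier
}.

Definition id_chart (V : normedModType R) : chart V V :=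
  @Chart V V setT setT id id openT openT
    (fun _ _ => I) (fun _ _ => I) (fun _ _ => erefl) (fun _ _ => erefl)
    (fun _ _ => cvg_id) (fun _ _ => cvg_id).

Definition vmanifold (V : normedModType R) : manifold V :=
  @Manifold V V (fun=> id_chart V) (fun _ => I)
    (fun _ _ => @smooth_on_id _ _ _) (@norm_hausdorff R V).

Lemma prod_open (T T' : topologicalType) (A : set T) (B : set T') :
  open A -> open B -> open (A `*` B).
Proof.
move=> oA oB; rewrite openE => z [Az Bz]; exists (A, B) => //.
by split; apply: open_nbhs_nbhs.
Qed.

Lemma prod_fun_continuous (T T' U U' : topologicalType) (f : T -> U)
    (g : T' -> U') (z : T * T') :
  {for z.1, continuous f} -> {for z.2, continuous g} ->
  {for z, continuous (fun z : T * T' => (f z.1, g z.2))}.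
Proof.
move=> cf cg; apply: cvg_pair.
  by apply: (@cvg_comp _ _ _ fst f); [exact: cvg_fst|exact: cf].
by apply: (@cvg_comp _ _ _ snd g); [exact: cvg_snd|exact: cg].
Qed.

Section ProductChart.
Context {V W : normedModType R} {T T' : topologicalType}
  (c : chart V T) (c' : chart W T').
Let pcoord (z : T * T') := (chart_coord c z.1, chart_coord c' z.2).
Let pparam (v : V * W) := (chart_param c v.1, chart_param c' v.2).

Let pcoord_cod z : (chart_dom c `*` chart_dom c') z ->
  (chart_cod c `*` chart_cod c') (pcoord z).
Proof. by case=> ? ?; split; exact: coord_cod. Qed.

Let pparam_dom v : (chart_cod c `*` chart_cod c') v ->
  (chart_dom c `*` chart_dom c') (pparam v).
Proof. by case=> ? ?; split; exact: param_dom. Qed.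

Let pcoordK z : (chart_dom c `*` chart_dom c') z -> pparam (pcoord z) = z.
Proof. by case: z => x y [? ?]; rewrite /pparam /= !chart_coordK. Qed.

Let pparamK v : (chart_cod c `*` chart_cod c') v -> pcoord (pparam v) = v.
Proof. by case: v => x y [? ?]; rewrite /pcoord /= !chart_paramK. Qed.

Let pcoord_continuous z : (chart_dom c `*` chart_dom c') z ->
  {for z, continuous pcoord}.
Proof.
by case=> ? ?; apply: prod_fun_continuous; exact: coord_continuous.
Qed.

Let pparam_continuous v : (chart_cod c `*` chart_cod c') v ->
  {for v, continuous pparam}.
Proof.
by case=> ? ?; apply: prod_fun_continuous; exact: param_continuous.
Qed.

Definition prod_chart : chart (V * W)%type (T * T')%type :=
  Chart (prod_open (chart_dom_open c) (chart_dom_open c'))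
    (prod_open (chart_cod_open c) (chart_cod_open c'))
    pcoord_cod pparam_dom pcoordK pparamK pcoord_continuous pparam_continuous.

End ProductChart.

Lemma prod_hausdorff (T T' : topologicalType) :
  hausdorff_space T -> hausdorff_space T' -> hausdorff_space (T * T')%type.
Proof.
move=> hT hT' [x x'] [y y'] xy; congr (_, _).
  apply: hT => A B Ax By.
  have [||z [/= Az Bz]] := xy (fst @^-1` A) (fst @^-1` B).
  - exact: (@cvg_fst _ _ (nbhs x) (nbhs x')).
  - exact: (@cvg_fst _ _ (nbhs y) (nbhs y')).
  by exists z.1.
apply: hT' => A B Ax By.
have [||z [/= Az Bz]] := xy (snd @^-1` A) (snd @^-1` B).
- exact: (@cvg_snd _ _ (nbhs x) (nbhs x')).
- exact: (@cvg_snd _ _ (nbhs y) (nbhs y')).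
by exists z.2.
Qed.

Lemma chart_overlap_open (V : normedModType R) (M : manifold V) (x y : M) :
  open (chart_cod (mchart x) `&` chart_param (mchart x) @^-1` chart_dom (mchart y)).
Proof.
rewrite openE => v [cv dv]; apply: filterI.
  exact: open_nbhs_nbhs (conj (chart_cod_open _) cv).
apply: (param_continuous cv).
exact: open_nbhs_nbhs (conj (chart_dom_open _) dv).
Qed.

Section ProductManifold.
Context {V W : normedModType R} (M : manifold V) (N : manifold W).
Let pchart (z : M * N) := prod_chart (mchart z.1) (mchart z.2).

Let pchart_dom z : chart_dom (pchart z) z.
Proof. by split; exact: mchart_dom. Qed.

Let pchart_compat x y : smooth_on
  (chart_cod (pchart x) `&` chart_param (pchart x) @^-1` chart_dom (pchart y))
  (chart_coord (pchart y) \o chart_param (pchart x)).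
Proof.
set S := (X in smooth_on X _).
have -> : S =
    (chart_cod (mchart x.1) `&`
       chart_param (mchart x.1) @^-1` chart_dom (mchart y.1)) `*`
    (chart_cod (mchart x.2) `&`
       chart_param (mchart x.2) @^-1` chart_dom (mchart y.2)).
  by apply/seteqP; split=> z [[? ?] [? ?]].
exact: (smooth_on_prod (chart_overlap_open _ _) (chart_overlap_open _ _)
  (mchart_compat _ _) (mchart_compat _ _)).
Qed.

Definition prod_manifold : manifold (V * W)%type :=
  Manifold pchart_dom pchart_compat
    (prod_hausdorff (@manifold_hausdorff _ M) (@manifold_hausdorff _ N)).

End ProductManifold.

Section Maps.
Context {V W : normedModType R} {M : manifold V} {N : manifold W}.

Definition local_rep (f : M -> N) (x : M) : V -> W :=
  chart_coord (mchart (f x)) \o f \o chart_param (mchart x).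

Definition msmooth_on (U : set M) (f : M -> N) : Prop :=
  forall x, U x -> {for x, continuous f} /\
    exists2 O, open_nbhs (chart_coord (mchart x) x) O &
               smooth_on O (local_rep f x).

Definition tmap (f : M -> N) (x : M) : V -> W :=
  'd (local_rep f x) (chart_coord (mchart x) x).

End Maps.

(* Smoothness on an arbitrary subset S of a vector space: locally, f extends
   to a smooth map on an open set. *)
Definition smooth_within {V W : normedModType R} {N : manifold W}
    (S : set V) (f : V -> N) : Prop :=
  forall x, S x -> exists U (g : vmanifold V -> N),
    [/\ open_nbhs x U, msmooth_on (M := vmanifold V) U g
      & forall y, S y -> U y -> f y = g y].

Definition locally_finite {T : topologicalType} (D : set (set T)) : Prop :=
  forall x : T, exists2 U, nbhs x U & finite_set [set B | D B /\ B `&` U !=set0].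

Definition paracompact (T : topologicalType) : Prop :=
  forall C : set (set T), C `<=` open -> \bigcup_(B in C) B = [set: T] ->
  exists D : set (set T),
    [/\ D `<=` open, \bigcup_(B in D) B = [set: T],
        (forall B, D B -> exists2 B', C B' & B `<=` B') & locally_finite D].

(* Parameter domains of curves: nondegenerate intervals containing 0, which is
   allowed to be an end point, so that the one-sided curves needed at the
   boundary of [0, 1] and at the corners of a path are included. *)
Definition curve_domain (J : set R) : Prop :=
  [/\ is_interval J, J 0 & exists2 s, J s & s != 0].

Definition has_velocity {V : normedModType R} {M : manifold V}
    (J : set R) (c : R -> M) (v : V) : Prop :=
  c @ within J (nbhs (0 : R)) --> c 0 /\
  s^-1 *: (chart_coord (mchart (c 0)) (c s) - chart_coord (mchart (c 0)) (c 0))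
    @[s --> within J (0 : R)^'] --> v.

(* A W-valued 1-form on X, as a partial function of tangent vectors: a
   tangent vector at x is represented by a curve c on J with c 0 = x, and the
   form returns the set of its values on the velocity of c at 0 (at most one
   value; none if the velocity does not exist). *)
Definition oneform (X W : Type) := set R -> (R -> X) -> set W.

Definition pullback_form {X Y W : Type} (f : X -> Y) (w : oneform Y W) :
  oneform X W := fun J c => w J (f \o c).

End Manifolds.

Section LieGroups.
Context {R : realType}.

Record lieGroup (VG : normedModType R) := LieGroup {
  lie_manifold :> manifold VG;
  gone : lie_manifold;
  gmul : lie_manifold -> lie_manifold -> lie_manifold;
  ginv : lie_manifold -> lie_manifold;
  gmulA : forall x y z, gmul x (gmul y z) = gmul (gmul x y) z;
  gmul1g : forall x, gmul gone x = x;
  gmulg1 : forall x, gmul x gone = x;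
  gmulVg : forall x, gmul (ginv x) x = gone;
  gmulgV : forall x, gmul x (ginv x) = gone;
  gmul_smooth : msmooth_on (M := prod_manifold lie_manifold lie_manifold)
    setT (fun z => gmul z.1 z.2);
  ginv_smooth : msmooth_on setT ginv
}.

(* The Lie algebra is the tangent space VG at the unit. *)
Definition Ad {VG : normedModType R} {G : lieGroup VG} (g : G) : VG -> VG :=
  tmap (fun x : G => gmul (gmul g x) (ginv g)) (gone G).

End LieGroups.

Section Bundles.
Context {R : realType} {VG VM : normedModType R}.

Record principalBundle (G : lieGroup VG) (M : manifold VM)
    (VP : normedModType R) := PrincipalBundle {
  btotal :> manifold VP;
  bproj : btotal -> M;
  act : btotal -> G -> btotal;
  bproj_smooth : msmooth_on setT bproj;
  act_smooth : msmooth_on (M := prod_manifold btotal G) setT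
    (fun z => act z.1 z.2);
  act1 : forall p, act p (gone G) = p;
  actM : forall p g h, act (act p g) h = act p (gmul g h);
  bproj_act : forall p g, bproj (act p g) = bproj p;
  (* around each point of M, an equivariant diffeomorphism (bproj, tau) of
     bproj^-1(U) onto U x G over U, with inverse sigma *)
  local_triviality : forall x : M, exists (U : set M) (tau : btotal -> G)
      (sigma : M * G -> btotal),
    [/\ open_nbhs x U,
        msmooth_on (bproj @^-1` U) tau,
        msmooth_on (M := prod_manifold M G) (U `*` setT) sigma &
        [/\ forall y g, U y -> bproj (sigma (y, g)) = y /\ tau (sigma (y, g)) = g,
            forall p, U (bproj p) -> sigma (bproj p, tau p) = p &
            forall p g, U (bproj p) -> tau (act p g) = gmul (tau p) g]]
}.

Lemma bproj_surj (G : lieGroup VG) (M : manifold VM) (VP : normedModType R)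
    (P : principalBundle G M VP) (x : M) : exists p : P, bproj p = x.
Proof.
have [U [tau [sigma [[_ Ux] _ _ [st _ _]]]]] := local_triviality P x.
by exists (sigma (x, gone G)); have [] := st _ (gone G) Ux.
Qed.

Definition fibre_point {G : lieGroup VG} {M : manifold VM}
    {VP : normedModType R} (P : principalBundle G M VP) (x : M) : P :=
  sval (cid (bproj_surj P x)).

Lemma fibre_pointP (G : lieGroup VG) (M : manifold VM) (VP : normedModType R)
    (P : principalBundle G M VP) (x : M) : bproj (fibre_point P x) = x.
Proof. exact: svalP (cid (bproj_surj P x)). Qed.

(* In [conn_vertical], [tmap (act p) gone] takes values in the tangent space at
   [act p gone], which is p by [act1].  In [conn_smooth], the constant vector
   field v in the chart around p0 is transported to the preferred charts at the
   nearby points. *)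
Record connection {G : lieGroup VG} {M : manifold VM} {VP : normedModType R}
    (P : principalBundle G M VP) := Connection {
  conn :> P -> {linear VP -> VG};
  conn_smooth : forall (p0 : P) (v : VP),
    smooth_on (chart_cod (mchart p0))
      (fun u => let p := chart_param (mchart p0) u in
                conn p ('d (chart_coord (mchart p) \o
                           chart_param (mchart p0)) u v));
  conn_equiv : forall (g : G) (p : P) (X : VP),
    conn (act p g) (tmap (fun p : P => act p g) p X) = Ad (ginv g) (conn p X);
  conn_vertical : forall (p : P) (xi : VG),
    conn p (tmap (fun g : G => act p g) (gone G) xi) = xi
}.

Definition conn_form {G : lieGroup VG} {M : manifold VM}
    {VP : normedModType R} {P : principalBundle G M VP} (A : connection P) :
    @oneform R P VG :=
  fun J c => [set A (c 0) v | v in has_velocity J c].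

End Bundles.

Section Paths.
Context {R : realType}.

Definition unitI : Type := {t : R | 0 <= t <= 1}.

Lemma clamp_subproof (s : R) : 0 <= Num.max 0 (Num.min 1 s) <= 1.
Proof. by rewrite le_max lexx /= ge_max ler01 ge_min lexx. Qed.

Definition clamp (s : R) : unitI :=
  exist (fun t : R => 0 <= t <= 1) _ (clamp_subproof s).

Definition subdivision (s : seq R) : Prop :=
  path.path <%R 0 s /\ last 0 s = 1.

Definition piece (s : seq R) (i : nat) : set R :=
  `[nth 0 (0 :: s) i, nth 0 s i]%classic.

Context {V : normedModType R} {M : manifold V}.

Definition piecewise_smooth (gamma : unitI -> M) : Prop :=
  exists2 s, subdivision s &
  forall i, (i < size s)%N -> smooth_within (piece s i) (gamma \o clamp).

(* Smooth curves in the spaces of paths and of loops: variations that are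
   smooth on the strips J x [s_i, s_{i+1}] of a common subdivision of [0, 1].
   This is the smooth structure used on these spaces: their tangent vectors at
   gamma are the piecewise smooth vector fields along gamma, and evaluation is
   smooth on each strip. *)
Definition smooth_variation (J : set R) (Gamma : R -> unitI -> M) : Prop :=
  exists2 s, subdivision s &
  forall i, (i < size s)%N ->
    smooth_within (V := (R * R)%type) (J `*` piece s i)
      (fun z => Gamma z.1 (clamp z.2)).

Definition pathSpace : set (unitI -> M) := piecewise_smooth.

Definition loopSpace : set (unitI -> M) :=
  [set gamma | piecewise_smooth gamma /\ gamma (clamp 0) = gamma (clamp 1)].

End Paths.
Arguments unitI : clear implicits.
Arguments pathSpace {R V} M.
Arguments loopSpace {R V} M.

Section ParallelTransport.
Context {R : realType} {VG VM VP : normedModType R} {G : lieGroup VG}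
  {M : manifold VM} {P : principalBundle G M VP}.
Variable A : connection P.

Definition horizontal (l : unitI R -> P) : Prop :=
  forall (t : unitI R) J, curve_domain J ->
    (forall s, J s -> 0 <= val t + s <= 1) ->
    conn_form A J (fun s => l (clamp (val t + s))) `<=` [set 0].

Definition is_horizontal_lift (gamma : unitI R -> M) (p : P)
    (l : unitI R -> P) : Prop :=
  [/\ piecewise_smooth l, forall t, bproj (l t) = gamma t, l (clamp 0) = p
    & horizontal l].

(* A piecewise smooth gamma has exactly one horizontal lift starting at a given
   p over gamma(0); [xget] selects it. *)
Definition horizontal_lift (gamma : unitI R -> M) (p : P) : unitI R -> P :=
  xget (fun=> p) (is_horizontal_lift gamma p).

Definition hol (gamma : unitI R -> M) (t : unitI R) (p q : P) : G :=
  xget (gone G) [set h | horizontal_lift gamma p t = act q h].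

End ParallelTransport.

Section PullbackBundles.
Context {R : realType} {VG VM VP : normedModType R} {G : lieGroup VG}
  {M : manifold VM} (P : principalBundle G M VP) {B : Type}.

Record pb (f : B -> M) := Pb {
  pb_base : B;
  pb_point : P;
  pb_eq : bproj pb_point = f pb_base
}.

Record fibre_prod (f f' : B -> M) := FProd {
  fp1 : pb f;
  fp2 : pb f';
  fp_eq : pb_base fp1 = pb_base fp2
}.

Definition covers_id {f f' : B -> M} (F : pb f -> pb f') : Prop :=
  forall w, pb_base (F w) = pb_base w.

(* The inverse of F, when F is bijective. *)
Definition pb_inv {f f' : B -> M} (F : pb f -> pb f') (z : pb f') : pb f :=
  match pselect (exists w, F w = z) with
  | left h => sval (cid h)
  | right _ => Pb (fibre_pointP P (f (pb_base z)))
  end.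

Lemma pb_inv_covers_id (f f' : B -> M) (F : pb f -> pb f') :
  covers_id F -> covers_id (pb_inv F).
Proof.
move=> cF z; rewrite /pb_inv; case: pselect => //= h.
by case: cid => w /= <-; rewrite cF.
Qed.

Lemma fprod_map_subproof (f1 f1' f2 f2' : B -> M) (F1 : pb f1 -> pb f1')
    (F2 : pb f2 -> pb f2') : covers_id F1 -> covers_id F2 ->
  forall z : fibre_prod f1 f2, pb_base (F1 (fp1 z)) = pb_base (F2 (fp2 z)).
Proof. by move=> c1 c2 z; rewrite c1 c2 fp_eq. Qed.

Definition fibre_prod_map {f1 f1' f2 f2' : B -> M} (F1 : pb f1 -> pb f1')
    (F2 : pb f2 -> pb f2') (c1 : covers_id F1) (c2 : covers_id F2)
    (z : fibre_prod f1 f2) : fibre_prod f1' f2' :=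
  FProd (fprod_map_subproof c1 c2 z).

Definition fibre_prod_form {f f' : B -> M} (w : @oneform R (pb f) VG)
    (w' : @oneform R (pb f') VG) : @oneform R (fibre_prod f f') (VG * VG)%type :=
  fun J c => [set xi | w J (@fp1 f f' \o c) xi.1 /\
                       w' J (@fp2 f f' \o c) xi.2].

Definition pb_conn (A : connection P) (f : B -> M) : @oneform R (pb f) VG :=
  pullback_form (@pb_point f) (conn_form A).

End PullbackBundles.
Arguments pb_conn {R VG VM VP G M P B} A f.

Section Evaluation.
Context {R : realType} {VG VM VP : normedModType R} {G : lieGroup VG}
  {M : manifold VM} {P : principalBundle G M VP}.
Variable A : connection P.
Variable E : set (unitI R -> M).

Definition EI : Type := ({gamma | E gamma} * unitI R)%type.
Definition ev (b : EI) : M := sval b.1 b.2.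
Definition ev0 (b : EI) : M := sval b.1 (clamp 0).

Definition smooth_base_curve (J : set R) (b : R -> EI) : Prop :=
  smooth_variation J (fun s => sval (b s).1) /\
  smooth_within (N := vmanifold R) J (fun s => val (b s).2).

Definition smooth_pb_curve (f : EI -> M) (J : set R) (c : R -> pb P f) :
    Prop :=
  smooth_base_curve J (@pb_base _ _ _ _ _ _ _ _ f \o c) /\
  smooth_within J (@pb_point _ _ _ _ _ _ _ _ f \o c).

Definition smooth_fprod_curve (f f' : EI -> M) (J : set R)
    (c : R -> fibre_prod P f f') : Prop :=
  smooth_pb_curve J (fun s => fp1 (c s)) /\
  smooth_pb_curve J (fun s => fp2 (c s)).

(* H(A)|_0^bullet *)
Definition Hol (z : fibre_prod P ev0 ev) : G :=
  let b := pb_base (fp1 z) in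
  hol A (sval b.1) b.2 (pb_point (fp1 z)) (pb_point (fp2 z)).

Lemma Phi_subproof (z : pb P ev0) :
  let b := pb_base z in let q := fibre_point P (ev b) in
  bproj (act q (hol A (sval b.1) b.2 (pb_point z) q)) = ev b.
Proof. by rewrite /= bproj_act fibre_pointP. Qed.

(* The point q of the fibre over gamma(t) used here is arbitrary. *)
Definition Phi (z : pb P ev0) : pb P ev := Pb (Phi_subproof z).

Lemma Phi_covers_id : covers_id Phi.
Proof. by []. Qed.

Definition Phi_odot_inv : fibre_prod P ev0 ev -> fibre_prod P ev ev0 :=
  fibre_prod_map Phi_covers_id (pb_inv_covers_id Phi_covers_id).

(* Equality of forms on ev_0^*P (.) ev^*P, tested on all velocities of smooth
   curves; since the right-hand side has a value on each of them, so does the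
   pulled-back form. *)
Definition intertwines_connections : Prop :=
  forall J (c : R -> fibre_prod P ev0 ev),
    curve_domain J -> smooth_fprod_curve J c ->
    pullback_form Phi_odot_inv
      (fibre_prod_form (pb_conn A ev) (pb_conn A ev0)) J c
    = fibre_prod_form (pb_conn A ev0) (pb_conn A ev) J c.

Definition horizontality_equation : Prop :=
  forall J (c : R -> fibre_prod P ev0 ev),
    curve_domain J -> smooth_fprod_curve J c ->
    let p := fun s => pb_point (fp1 (c s)) in
    let q := fun s => pb_point (fp2 (c s)) in
    let h := Hol (c 0) in
    forall Xp Xq, has_velocity J p Xp -> has_velocity J q Xq ->
    exists2 TH, has_velocity J (fun s => Hol (c s)) TH &
      TH + tmap (fun g : G => gmul g h) (gone G) (A (q 0) Xq)
         - tmap (fun g : G => gmul h g) (gone G) (A (p 0) Xp) = 0.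

End Evaluation.

(* Main.v *)
From HB Require Import structures.
Require Import Defs.
From mathcomp Require Import all_boot all_order all_algebra.
From mathcomp Require Import all_classical all_reals all_analysis.
From mathcomp Require Import ring lra.

Set Implicit Arguments.
Unset Strict Implicit.
Unset Printing Implicit Defensive.

Import Order.TTheory GRing.Theory Num.Theory.
Import numFieldNormedType.Exports.
Local Open Scope classical_set_scope.
Local Open Scope ring_scope.

(** Fix a point (gamma; t; p, q) and let h = H(A; gamma; t; p, q).  The
    horizontal lift of gamma from p is at q h at time t, so Phi_A sends p to q h
    and, lifts from p g being the right translates by g of lifts from p, its
    inverse sends q to p h^-1.  Hence Phi_A . Phi_A^-1 is the map
    (p, q) |-> (q h, p h^-1) ([Phi_odot_inv1], [Phi_odot_inv2]), and the
    intertwining condition says that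
      A ((q h)') = A (p')   and   A ((p h^-1)') = A (q')
    along every smooth curve.  The Leibniz rule ([velocity_act]) reads
      L_h (A ((q h)')) = h' + R_h (A (q')).
    Since L_h is injective, the first equation is the horizontality equation.
    The second one is then automatic: apply the Leibniz rule to p = (p h^-1) h
    and use that R_h is injective.  As forms are only defined on curves that
    have a velocity, differentiability of h is part of both conditions.  It
    passes from h to q h and p h^-1 since the action is smooth, and back because
    h is a quotient of q h by q, smooth in local trivializations
    ([velocity_quotient]).

    All this uses that horizontal lifts exist and are unique, so that Phi_A and
    H are what their definitions intend.

    Uniqueness ([lift_unique]): two lifts of gamma with the same origin differ by
    a G-valued function, whose one-sided velocities vanish by the Leibniz rule;
    such a function is constant ([zero_velocity_constant]).

    Existence ([liftable_pieces]): near each time, correct an arbitrary smooth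
    lift b by a G-valued function h solving h' = - R_h (A (b')), which in a chart
    of G is an ordinary differential equation with smooth coefficients
    ([local_horizontal_lift], [ode_local_solution]).  Right translation moves
    this lift to any starting point of the fibre, and interval induction
    ([interval_chain]) concatenates the local lifts.

    Velocities are handled throughout as limits of difference quotients along
    one-sided domains.  Every tangent vector is the velocity of some curve and
    velocities are unique, so that identities between tangent maps come from
    comparing two velocities of the same curve. *)

(** * Interval induction and the mean value inequality *)

Section Intervals.
Context {R : realType}.

(** Interval induction in Cousin's form.  The local hypothesis only concerns
    intervals that contain the point t: this is all that one-sided information
    on both sides of t can provide, and it suffices because the supremum of the
    points reachable from a lies inside such an interval. *)
Lemma interval_chain (Q : R -> R -> Prop) (a b : R) : a <= b ->
  (forall x y z, a <= x <= y -> y <= z <= b -> Q x y -> Q y z -> Q x z) ->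
  (forall t, a <= t <= b -> exists2 e : R, 0 < e & forall x y,
     a <= x -> y <= b -> x <= t <= y -> t - e < x -> y < t + e -> Q x y) ->
  Q a b.
Proof.
move=> ab Qtr Qloc.
pose S := [set t | a <= t <= b /\ Q a t].
have Sa : S a.
  split; first by rewrite lexx.
  have [|e e0 He] := Qloc a; first by rewrite lexx.
  by apply: He; rewrite ?lexx// ?ltrBlDr ltrDl.
have Sb : ubound S b by move=> t [/andP[]].
have hS : has_sup S by split; [exists a | exists b].
set s := sup S.
have as_ : a <= s by apply: ub_le_sup => //; exists b.
have sb : s <= b by apply: ge_sup => //; exists a.
have [|e e0 He] := Qloc s; first by rewrite as_ sb.
have [t [tab Qt] st] : exists2 t, S t & s - e < t by exact: sup_adherent.
have ts : t <= s by apply: ub_le_sup => //; exists b.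
have /andP[at_ tb] := tab.
pose y := Num.min b (s + e / 2).
have yb : y <= b by rewrite ge_min lexx.
have sy : s <= y by rewrite le_min sb lerDl divr_ge0// ltW.
have ye : y < s + e by rewrite gt_min ltrD2l ltr_pdivrMr// mulr_natr mulr2n ltrDr e0 orbT.
have Qy : Q a y.
  by apply: (Qtr a t y); rewrite ?lexx ?at_ ?(le_trans ts sy)//; apply: He; rewrite ?ts.
have Sy : S y by split=> //; rewrite (le_trans as_ sy).
have ys : y <= s by apply: ub_le_sup => //; exists b.
suff -> : b = y by [].
apply/eqP; rewrite eq_le yb andbT; move: ys; rewrite {1}/y ge_min => /orP[bs|].
  exact: le_trans bs sy.
by rewrite gerDl leNgt divr_gt0.
Qed.

(** The bound with slope K + e is additive over adjacent intervals and holds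
    around each point, so [interval_chain] propagates it; then e tends to 0.
    The hypothesis is an estimate rather than a derivative so that one-sided
    derivatives at corners are covered. *)
Lemma mean_value_bound (W : normedModType R) (u : R -> W) (K a b : R) : a <= b ->
  (forall t, a <= t <= b -> forall e : R, 0 < e -> exists2 d : R, 0 < d &
     forall s, a <= s <= b -> `|s - t| < d -> `|u s - u t| <= (K + e) * `|s - t|) ->
  `|u b - u a| <= K * (b - a).
Proof.
move=> ab H.
suff He (e : R) : 0 < e -> `|u b - u a| <= (K + e) * (b - a).
  apply/ler_addgt0Pr => e e0.
  have d0 : 0 < b - a + 1 by rewrite ltr_pwDr// subr_ge0.
  have := He (e / (b - a + 1)) (divr_gt0 e0 d0).
  move/le_trans; apply; rewrite mulrDl lerD2l.
  by rewrite mulrAC ler_pdivrMr// ler_pM2l// lerDl.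
move=> e0.
apply: (@interval_chain (fun x y => `|u y - u x| <= (K + e) * (y - x))) => //.
  move=> x y z _ _ xy yz; rewrite (_ : u z - u x = (u z - u y) + (u y - u x)); last first.
    by rewrite addrA subrK.
  apply: (le_trans (ler_normD _ _)); rewrite (_ : z - x = (z - y) + (y - x)); last by ring.
  by rewrite mulrDr lerD.
move=> t tab; have [d d0 Hd] := H t tab e e0; exists d => // x y ax yb /andP[xt ty] tx yt.
rewrite (_ : u y - u x = (u y - u t) - (u x - u t)); last by rewrite opprB addrA subrK.
apply: (le_trans (ler_normB _ _)).
rewrite (_ : y - x = (y - t) + (t - x)); last by ring.
rewrite [leRHS]mulrDr.
apply: lerD.
  rewrite -(ger0_norm (_ : 0 <= y - t)) ?subr_ge0//; apply: Hd.
    by rewrite yb andbT (le_trans ax)// (le_trans xt).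
  by rewrite ger0_norm ?subr_ge0// ltrBlDl.
rewrite -(ger0_norm (_ : 0 <= t - x)) ?subr_ge0// (distrC t); apply: Hd.
  by rewrite ax /= (le_trans xt)// (le_trans ty).
by rewrite distrC ger0_norm ?subr_ge0// ltrBlDl -ltrBlDr.
Qed.

Lemma derivable_growth (W : normedModType R) (u : R -> W) (t : R) (v : W) :
  is_derive t (1 : R) u v -> forall e : R, 0 < e -> exists2 d : R, 0 < d &
  forall s, `|s - t| < d -> `|u s - u t - (s - t) *: v| <= e * `|s - t|.
Proof.
move=> [du vE] e e0.
have : h^-1 *: (u (h *: (1:R) + t) - u t) @[h --> 0^'] --> v.
  by rewrite -vE; exact: du.
move/cvgr_dist_le => /(_ e e0) /=.
rewrite near_withinE => /nbhs_ballP[d /= d0 Hd].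
exists d => // s sd; have [->|st] := eqVneq s t.
  by rewrite !subrr scale0r normr0 subrr normr0 mulr0.
have st0 : s - t != 0 by rewrite subr_eq0.
have := Hd (s - t); rewrite /ball /= sub0r normrN => /(_ sd st0).
rewrite /GRing.scale /= mulr1 subrK -/GRing.scale => He.
have -> : u s - u t - (s - t) *: v = - ((s - t) *: (v - (s - t)^-1 *: (u s - u t))).
  by rewrite scalerBr scalerA divff// scale1r opprB.
by rewrite normrN normrZ mulrC ler_wpM2r.
Qed.

Lemma mean_value_derive (W : normedModType R) (u : R -> W) (K a b : R) : a <= b ->
  (forall t, a <= t <= b -> derivable u t 1 /\ `|'D_1 u t| <= K) ->
  `|u b - u a| <= K * (b - a).
Proof.
move=> ab H; apply: mean_value_bound => // t tab e e0.
have [du duK] := H t tab.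
have [d d0 Hd] := derivable_growth (derivableP du) e0.
exists d => // s _ sd; rewrite -(subrK ((s - t) *: 'D_1 u t) (u s - u t)).
rewrite (le_trans (ler_normD _ _))// mulrDl addrC lerD ?Hd// normrZ mulrC.
by rewrite ler_wpM2r.
Qed.

End Intervals.

(** * Calculus of smooth maps between finite-dimensional spaces *)

Section CkCalculus.
Context {R : realType}.
Implicit Types V W X : normedModType R.

(** A resolution of the identity by continuous functionals: the form in which
    finite dimension passes to products and enters the chain rule [Ck_comp]. *)
Definition coordinates (W : normedModType R) (n : nat) (e : 'I_n -> W)
    (c : 'I_n -> {linear W -> R}) : Prop :=
  (forall j, continuous (c j)) /\ forall w, w = \sum_j c j w *: e j.

Definition findim (W : normedModType R) : Prop :=
  exists n (e : 'I_n -> W) (c : 'I_n -> {linear W -> R}), coordinates e c.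

Lemma findim_real : findim R.
Proof.
exists 1%N, (fun=> 1), (fun=> idfun); split=> [j x|w]; first exact: cvg_id.
by rewrite big_ord1 /= /GRing.scale /= mulr1.
Qed.

Lemma findim_rV (d : nat) : findim 'rV[R]_d.
Proof.
have clin (j : 'I_d) : linear (fun x : 'rV[R]_d => x ord0 j).
  by move=> a x y; rewrite !mxE.
pose c (j : 'I_d) : {linear 'rV[R]_d -> R} :=
  HB.pack (fun x : 'rV[R]_d => x ord0 j) (GRing.isLinear.Build _ _ _ _ _ (clin j)).
exists d, (fun j => delta_mx ord0 j), c; split.
  move=> j x; exact: (@coord_continuous R 1 d ord0 j x).
by move=> w; rewrite {1}(row_sum_delta w).
Qed.

Lemma findim_prod V W : findim V -> findim W -> findim (V * W)%type.
Proof.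
move=> [n [e [c [cc ec]]]] [m [f [g [cg fg]]]].
have l1 (j : 'I_n) : linear (fun z : V * W => c j z.1) by move=> a x y; rewrite /= linearP.
have l2 (j : 'I_m) : linear (fun z : V * W => g j z.2) by move=> a x y; rewrite /= linearP.
have [c1 c1E] : exists c1 : 'I_n -> {linear (V * W)%type -> R},
    forall j, c1 j = (fun z : V * W => c j z.1) :> (V * W -> R).
  by exists (fun j => HB.pack_for {linear (V * W)%type -> R}
    (fun z : V * W => c j z.1) (GRing.isLinear.Build _ _ _ _ _ (l1 j))).
have [c2 c2E] : exists c2 : 'I_m -> {linear (V * W)%type -> R},
    forall j, c2 j = (fun z : V * W => g j z.2) :> (V * W -> R).
  by exists (fun j => HB.pack_for {linear (V * W)%type -> R}
    (fun z : V * W => g j z.2) (GRing.isLinear.Build _ _ _ _ _ (l2 j))).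
exists (n + m)%N, (fun k : 'I_(n + m) =>
    match fintype.split k with inl i => (e i, 0) | inr j => (0, f j) end),
  (fun k : 'I_(n + m) => match fintype.split k with inl i => c1 i | inr j => c2 j end).
split.
  move=> k; case: fintype.split => i z /=; rewrite ?c1E ?c2E.
    by apply: (@cvg_comp _ _ _ fst (c i)); [exact: cvg_fst|exact: cc].
  by apply: (@cvg_comp _ _ _ snd (g i)); [exact: cvg_snd|exact: cg].
move=> [v w]; rewrite big_split_ord /=.
under eq_bigr => i _ do rewrite (unsplitK (inl i)) /= c1E.
under [X in _ + X]eq_bigr => i _ do rewrite (unsplitK (inr i)) /= c2E.
have s1 (I : finType) (a : I -> R) (b : I -> V) :
    \sum_i a i *: (b i, 0 : W) = (\sum_i a i *: b i, 0).
  rewrite (big_morph (fun x : V => (x, 0 : W)) (id1 := 0) (op1 := +%R)) //.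
    by apply: eq_bigr => i _; congr (_, _); rewrite /= scaler0.
  by move=> x y; congr (_, _); rewrite addr0.
have s2 (I : finType) (a : I -> R) (b : I -> W) :
    \sum_i a i *: (0 : V, b i) = (0, \sum_i a i *: b i).
  rewrite (big_morph (fun x : W => (0 : V, x)) (id1 := 0) (op1 := +%R)) //.
    by apply: eq_bigr => i _; congr (_, _); rewrite /= scaler0.
  by move=> x y; congr (_, _); rewrite addr0.
by rewrite s1 s2 -ec -fg; congr (_, _); rewrite /= ?addr0 ?add0r.
Qed.

Lemma Ck_sub V W k (U U' : set V) (f : V -> W) : U' `<=` U -> Ck k U f -> Ck k U' f.
Proof.
move=> UU; elim: k f => [|k IH] f /=; first by move=> cf x /UU/cf.
by move=> [df Df]; split=> [x /UU/df//|v]; exact: IH.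
Qed.

Lemma Ck_S V W k (U : set V) (f : V -> W) : Ck k.+1 U f -> Ck k U f.
Proof.
elim: k f => [|k IH] f; first by move=> [df _] x Ux; exact/differentiable_continuous/df.
by move=> [df Df]; split=> // v; apply: IH; exact: Df.
Qed.

Lemma Ck_cst V W k (U : set V) (c : W) : Ck k U (fun=> c).
Proof.
elim: k c => [|k IH] c /=; first by move=> x _; exact: cvg_cst.
split=> [x _|v]; first exact: differentiable_cst.
by rewrite (_ : 'D_v _ = fun=> 0) //; apply/funext => x; exact: derive_cst.
Qed.

Lemma Ck_linear V W k (U : set V) (l : {linear V -> W}) : continuous l -> Ck k U l.
Proof.
move=> cl; case: k => [|k] /=; first by move=> x _; exact: cl.
split=> [x _|v]; first exact: linear_differentiable.
rewrite (_ : 'D_v _ = fun=> l v); first exact: Ck_cst.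
apply/funext => x; rewrite deriveE ?diff_lin//; exact: linear_differentiable.
Qed.

Lemma derive_linear_comp V W X (l : {linear W -> X}) (f : V -> W) x v :
  continuous l -> differentiable f x -> 'D_v (l \o f) x = l ('D_v f x).
Proof.
move=> cl df; have dl := @linear_differentiable _ _ _ l (f x) cl.
rewrite deriveE; last exact: differentiable_comp.
by rewrite diff_comp//= diff_lin// deriveE.
Qed.

Lemma Ck_linear_comp V W X k (U : set V) (l : {linear W -> X}) (f : V -> W) :
  open U -> continuous l -> Ck k U f -> Ck k U (l \o f).
Proof.
move=> oU cl; elim: k f => [|k IH] f /=.
  by move=> cf x Ux; apply: continuous_comp; [exact: cf|exact: cl].
move=> [df Df]; split=> [x Ux|v].
  by apply: differentiable_comp; [exact: df|exact: linear_differentiable].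
apply: (@Ck_eq _ _ _ k U (l \o 'D_v f)) => // [x Ux|]; last exact: IH.
by rewrite derive_linear_comp//; exact: df.
Qed.

Lemma derive_pair V W X (f : V -> W) (g : V -> X) x v :
  differentiable f x -> differentiable g x ->
  'D_v (fun y => (f y, g y)) x = ('D_v f x, 'D_v g x).
Proof.
move=> df dg; rewrite !deriveE//; last exact: differentiable_pair.
by rewrite diff_pair.
Qed.

Lemma Ck_pair V W X k (U : set V) (f : V -> W) (g : V -> X) :
  open U -> Ck k U f -> Ck k U g -> Ck k U (fun x => (f x, g x)).
Proof.
move=> oU; elim: k f g => [|k IH] f g /=.
  by move=> cf cg x Ux; apply: cvg_pair; [exact: cf|exact: cg].
move=> [df Df] [dg Dg]; split=> [x Ux|v].
  by apply: differentiable_pair; [exact: df|exact: dg].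
apply: (@Ck_eq _ _ _ k U (fun x => ('D_v f x, 'D_v g x))) => // [x Ux|].
  by rewrite derive_pair//; [exact: df|exact: dg].
exact: IH.
Qed.

Lemma CkD V W k (U : set V) (f g : V -> W) :
  open U -> Ck k U f -> Ck k U g -> Ck k U (fun x => f x + g x).
Proof.
move=> oU; elim: k f g => [|k IH] f g /=.
  by move=> cf cg x Ux; apply: cvgD; [exact: cf|exact: cg].
move=> [df Df] [dg Dg]; split=> [x Ux|v].
  by apply: differentiableD; [exact: df|exact: dg].
apply: (@Ck_eq _ _ _ k U (fun x => 'D_v f x + 'D_v g x)) => // [x Ux|].
  by rewrite -deriveD//; apply: diff_derivable; [exact: df|exact: dg].
exact: IH.
Qed.

Lemma derive_comp V W X (f : V -> W) (g : W -> X) x v :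
  differentiable f x -> differentiable g (f x) ->
  'D_v (g \o f) x = 'd g (f x) ('D_v f x).
Proof.
move=> df dg; have -> : 'D_v (g \o f) x = 'd (g \o f) x v.
  by apply: deriveE; exact: differentiable_comp.
by rewrite (diff_comp df dg) /= (deriveE _ df).
Qed.

Lemma Ck_sum V W k (U : set V) n (f : 'I_n -> V -> W) :
  open U -> (forall i, Ck k U (f i)) -> Ck k U (fun x => \sum_i f i x).
Proof.
move=> oU; elim: n f => [|n IH] f Cf.
  by under eq_fun do rewrite big_ord0; exact: Ck_cst.
under eq_fun do rewrite big_ord_recr /=.
by apply: CkD => //; apply: IH.
Qed.

Lemma scale_is_bilinear W :
  bilinear_for
    (GRing.Scale.Law.clone _ _ ( *:%R ) _) (GRing.Scale.Law.clone _ _ ( *:%R ) _)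
    (fun (a : R) (w : W) => a *: w).
Proof.
split=> [u' a x y|u a x y] /=.
  by rewrite scalerDl -scalerA.
by rewrite scalerDr !scalerA mulrC.
Qed.

Definition scale_bilinear (W : normedModType R) : {bilinear R -> W -> W} :=
  HB.pack (fun (a : R) (w : W) => a *: w)
    (bilinear_isBilinear.Build _ _ _ _ _ _ _ (scale_is_bilinear W)).

Lemma differentiable_scale V W (a : V -> R) (f : V -> W) x :
  differentiable a x -> differentiable f x ->
  differentiable (fun y => a y *: f y) x.
Proof.
move=> da df.
have cb : continuous (fun p : R * W => scale_bilinear W p.1 p.2).
  by move=> p; exact: scale_continuous.
have := @differentiable_comp _ _ _ _ (fun y => (a y, f y)) (fun p => scale_bilinear W p.1 p.2) x.
apply; first exact: differentiable_pair.
exact: differentiable_bilin.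
Qed.

Lemma derive_scale V W (a : V -> R) (f : V -> W) x v :
  differentiable a x -> differentiable f x ->
  'D_v (fun y => a y *: f y) x = a x *: 'D_v f x + 'D_v a x *: f x.
Proof.
move=> da df; rewrite !deriveE//; last exact: differentiable_scale.
have cb : continuous (fun p : R * W => scale_bilinear W p.1 p.2).
  by move=> p; exact: scale_continuous.
rewrite (_ : (fun y => a y *: f y) =
  (fun p => scale_bilinear W p.1 p.2) \o (fun y => (a y, f y)))//.
rewrite diff_comp; last 2 first.
- exact: differentiable_pair.
- exact: differentiable_bilin.
rewrite diff_pair//.
have E := @diff_bilin _ _ _ _ (scale_bilinear W) (a x, f x) cb.
exact: (congr1 (fun F : R * W -> W => F ('d a x v, 'd f x v)) E).
Qed.

Lemma Ck_scale V W k (U : set V) (a : V -> R) (f : V -> W) :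
  open U -> Ck k U a -> Ck k U f -> Ck k U (fun x => a x *: f x).
Proof.
move=> oU; elim: k a f => [|k IH] a f.
  by move=> ca cf x Ux; apply: cvgZ; [exact: ca|exact: cf].
move=> Ca Cf; have [/= da Da] := Ca; have [/= df Df] := Cf; split=> [x Ux|v].
  by apply: differentiable_scale; [exact: da|exact: df].
apply: (@Ck_eq _ _ _ k U (fun x => a x *: 'D_v f x + 'D_v a x *: f x)) => // [x Ux|].
  by rewrite derive_scale//; [exact: da|exact: df].
by apply: CkD => //; [apply: IH (Df v); exact: Ck_S Ca|apply: IH (Da v) _; exact: Ck_S Cf].
Qed.

Lemma diff_coordinates V W n (e : 'I_n -> V) (c : 'I_n -> {linear V -> R})
    (g : V -> W) x v : coordinates e c -> differentiable g x ->
  'd g x v = \sum_j c j v *: 'D_(e j) g x.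
Proof.
move=> [_ ec] dg; rewrite {1}(ec v) linear_sum.
by apply: eq_bigr => j _; rewrite linearZ deriveE.
Qed.

(** In D_v (g o f) the map g is differentiated in the moving direction D_v f x.
    Expanding that direction in coordinates of W leaves derivatives of g in
    fixed directions, to which the induction hypothesis applies; this is where
    the finite dimension of W enters. *)
Lemma Ck_comp V W X k (U : set V) (U' : set W) (f : V -> W) (g : W -> X) :
  findim W -> open U -> (forall x, U x -> U' (f x)) ->
  Ck k U f -> Ck k U' g -> Ck k U (g \o f).
Proof.
move=> [n [e [c ec]]] oU UU'; elim: k f g UU' => [|k IH] f g UU'.
  by move=> cf cg x Ux; apply: continuous_comp; [exact: cf|exact/cg/UU'].
move=> Cf Cg; have [/= df Df] := Cf; have [/= dg Dg] := Cg; split=> [x Ux|v].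
  by apply: differentiable_comp; [exact: df|exact/dg/UU'].
apply: (@Ck_eq _ _ _ k U (fun x => \sum_j c j ('D_v f x) *: ('D_(e j) g \o f) x)) => // [x Ux|].
  have dfx := df x Ux; have dgx := dg _ (UU' x Ux).
  transitivity ('d g (f x) ('D_v f x)); first by rewrite (diff_coordinates _ ec dgx).
  by rewrite derive_comp.
apply: Ck_sum => // j; apply: Ck_scale => //.
  exact: (@Ck_linear_comp _ _ _ k U (c j) ('D_v f) oU (ec.1 j) (Df v)).
exact: (IH f _ UU' (Ck_S Cf) (Dg (e j))).
Qed.

Lemma smooth_on_comp V W X (U : set V) (U' : set W) (f : V -> W) (g : W -> X) :
  findim W -> open U -> (forall x, U x -> U' (f x)) ->
  smooth_on U f -> smooth_on U' g -> smooth_on U (g \o f).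
Proof. by move=> fW oU UU' sf sg k; apply: (Ck_comp fW oU UU'). Qed.

Lemma Ck_fst V W k (U : set (V * W)) : Ck k U (@fst V W).
Proof.
have flin : linear (@fst V W) by [].
pose fL : {linear _ -> _} := HB.pack (@fst V W) (GRing.isLinear.Build _ _ _ _ _ flin).
by apply: (@Ck_linear _ _ _ _ fL) => a; exact: cvg_fst.
Qed.

Lemma Ck_snd V W k (U : set (V * W)) : Ck k U (@snd V W).
Proof.
have flin : linear (@snd V W) by [].
pose fL : {linear _ -> _} := HB.pack (@snd V W) (GRing.isLinear.Build _ _ _ _ _ flin).
by apply: (@Ck_linear _ _ _ _ fL) => a; exact: cvg_snd.
Qed.

End CkCalculus.

(** * Ordinary differential equations *)

Section ODE.
Context {R : realType}.

(** The nearest-point projection onto the interval of centre c and radius r.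
    Composing with it turns a field defined on a box into a field on the whole
    space with the same bound and the same Lipschitz constant. *)
Definition clampR (c r t : R) : R := Num.max (c - r) (Num.min (c + r) t).

Lemma clampR_dist c r t : 0 <= r -> `|clampR c r t - c| <= r.
Proof.
move=> r0; rewrite ler_distl /clampR le_max lexx /= ge_max ge_min lexx /= andbT.
by rewrite lerD2l (le_trans _ r0)// oppr_le0.
Qed.

Lemma clampR_id c r t : `|t - c| <= r -> clampR c r t = t.
Proof.
by rewrite ler_distl /clampR => /andP[h1 h2]; rewrite min_r// max_r.
Qed.

Lemma clampR_lip c r t s : `|clampR c r t - clampR c r s| <= `|t - s|.
Proof.
have maxlip (a x y : R) : `|Num.max a x - Num.max a y| <= `|x - y|.
  by case: (leP a x) => h1; case: (leP a y) => h2; case: (lerP x y) => h3;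
    rewrite ?subrr ?normr0 ?ler_norml //; lra.
have minlip (a x y : R) : `|Num.min a x - Num.min a y| <= `|x - y|.
  by case: (leP a x) => h1; case: (leP a y) => h2; case: (lerP x y) => h3;
    rewrite ?subrr ?normr0 ?ler_norml //; lra.
exact: le_trans (maxlip _ _ _) (minlip _ _ _).
Qed.

Lemma pair_continuous (S T U : topologicalType) (f : S -> T) (g : S -> U) (x : S) :
  {for x, continuous f} -> {for x, continuous g} ->
  {for x, continuous (fun s => (f s, g s))}.
Proof. by move=> cf cg; apply: cvg_pair; [exact: cf|exact: cg]. Qed.

Lemma lipschitz_continuous (V W : normedModType R) (f : V -> W) (K : R) :
  (forall x y, `|f x - f y| <= K * `|x - y|) -> continuous f.
Proof.
move=> fK x; apply/cvgrPdist_lt => e e0.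
have K0 : 0 < `|K| + 1 by rewrite ltr_pwDr.
near=> y; apply: le_lt_trans (fK _ _) _.
have : `|x - y| < e / (`|K| + 1).
  by near: y; apply: (@cvgr_dist_lt _ _ _ _ _ id x); [exact: cvg_id|exact: divr_gt0].
rewrite ltr_pdivlMr// mulrC; apply: le_lt_trans; rewrite ler_wpM2r//.
by rewrite (le_trans (ler_norm _))// lerDl.
Unshelve. all: by end_near. Qed.

Lemma row_norm_le d (x : 'rV[R]_d) r : 0 <= r ->
  (forall j, `|x ord0 j| <= r) -> `|x| <= r.
Proof.
move=> r0 H; rewrite /Num.Def.normr/= mx_normrE (bigmax_le _ r0)//= => -[i j] _ /=.
by rewrite ord1.
Qed.

Lemma row_norm_ge d (x : 'rV[R]_d) j : `|x ord0 j| <= `|x|.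
Proof.
by rewrite [leRHS]/Num.Def.normr/= mx_normrE; exact: (le_bigmax _ _ (ord0, j)).
Qed.

Lemma antiderivative_real (g : R -> R) (t0 : R) : continuous g ->
  exists2 G : R -> R, G t0 = 0 & forall t, `|t - t0| < 2 -> is_derive t 1 G (g t).
Proof.
move=> cg; set mu := (@lebesgue_measure R).
pose F x := (\int[mu]_(t in `[t0 - 2, x]) g t)%R.
have ig : mu.-integrable `[t0 - 2, t0 + 2] (EFin \o g).
  apply: continuous_compact_integrable; first exact: segment_compact.
  exact: continuous_subspaceT.
have dF t : `|t - t0| < 2 -> is_derive t 1 F (g t).
  rewrite ltr_distl => /andP[at_ tb].
  have [dF F'] := continuous_FTC1_closed tb ig at_ (cg t).
  by split; [exact: dF|rewrite -derive1E].
exists (fun t => F t - F t0) => [|t td]; first by rewrite subrr.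
exact: is_derive_eq (is_deriveB (dF t td) (is_derive_cst (F t0) t 1)) (subr0 _).
Qed.

(** The antiderivative is made constant outside the unit ball around t0: it is
    then continuous on the whole line and the construction can be iterated. *)
Lemma antiderivative d (g : R -> 'rV[R]_d) (t0 : R) : continuous g ->
  exists G : R -> 'rV[R]_d, [/\ G t0 = 0, continuous G &
    forall t, `|t - t0| < 1 -> is_derive t 1 G (g t)].
Proof.
move=> cg.
have /choice[G HG] : forall j : 'I_d, exists G : R -> R, G t0 = 0 /\
    forall t, `|t - t0| < 2 -> is_derive t 1 G (g t ord0 j).
  move=> j; have [|G G0 dG] := @antiderivative_real (fun t => g t ord0 j) t0.
    move=> t; apply: (@continuous_comp _ _ _ g (fun M : 'rV[R]_d => M ord0 j)).
      exact: cg.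
    exact: (@coord_continuous R 1 d).
  by exists G.
have dG t : `|t - t0| < 2 -> is_derive t 1 (fun t => \row_j G j t : 'rV[R]_d) (g t).
  move=> td; have dM : derivable (fun t => \row_j G j t : 'rV[R]_d) t 1.
    apply/derivable_mxP => i j; rewrite (_ : (fun x => _) = G j).
      by have [] := (HG j).2 t td.
    by apply/funext => x; rewrite mxE.
  split=> //; rewrite derive_mx//; apply/rowP => j; rewrite mxE.
  rewrite (_ : (fun x => _) = G j); first by have [] := (HG j).2 t td.
  by apply/funext => x; rewrite mxE.
exists (fun t => \row_j G j (clampR t0 1 t)); split.
- by apply/rowP => j; rewrite !mxE clampR_id ?subrr ?normr0// (HG j).1.
- move=> t; apply: (@continuous_comp _ _ _ (clampR t0 1) (fun t => \row_j G j t)).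
    by apply: (@lipschitz_continuous _ _ _ 1) => x y; rewrite mul1r clampR_lip.
  apply: differentiable_continuous; apply/derivable1_diffP.
  have [] // := dG (clampR t0 1 t).
  by apply: le_lt_trans (clampR_dist _ _ _) _ => //; rewrite ltr1n.
- move=> t t1; have dGt : `|t - t0| < 2 by rewrite (lt_trans t1)// ltr1n.
  move: dGt => /dG dGt.
  apply: near_eq_is_derive dGt.
  have : nbhs t (ball t0 1).
    by apply: open_nbhs_nbhs; split; [exact: ball_open|rewrite /ball /= distrC].
  apply: filterS => s; rewrite /ball /= distrC => /ltW s1.
  by rewrite clampR_id.
Qed.

Lemma geometric_cauchy_real (x : nat -> R) (C : R) :
  (forall n, `|x n.+1 - x n| <= C / 2 ^+ n) ->
  exists l, forall n, `|l - x n| <= 2 * C / 2 ^+ n.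
Proof.
move=> H.
have C0 : 0 <= C by have := H 0%N; rewrite expr0 divr1; apply: le_trans.
have Hk n k : `|x (n + k)%N - x n| <= 2 * C / 2 ^+ n.
  suff Hk : `|x (n + k)%N - x n| <= 2 * C / 2 ^+ n - 2 * C / 2 ^+ (n + k).
    by rewrite (le_trans Hk)// gerBl divr_ge0// ?mulr_ge0// exprn_ge0.
  elim: k => [|k IH]; first by rewrite addn0 !subrr normr0.
  rewrite addnS (_ : x (n + k).+1 - x n = (x (n + k).+1 - x (n + k)%N) + (x (n + k)%N - x n)).
    rewrite (le_trans (ler_normD _ _))//.
    rewrite (le_trans (lerD (H _) IH))// exprS invfM.
    set a := (2 ^+ n)^-1; set b := (2 ^+ (n + k))^-1.
    rewrite (_ : 2 * C * (2^-1 * b) = C * b); last by rewrite mulrACA divff ?mul1r// pnatr_eq0.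
    by rewrite le_eqVlt; apply/orP; left; apply/eqP; ring.
  by rewrite addrA subrK.
have e2 : (fun n => 2 * C / 2 ^+ n) @ \oo --> (0 : R).
  rewrite -(mulr0 (2 * C)); apply: cvgMr.
  have := @cvg_geometric R 1 2^-1; rewrite ger0_norm ?invr_ge0// invf_lt1 ?ltr0n// ltr1n.
  move=> /(_ isT); apply: cvg_trans; apply: near_eq_cvg; near=> n.
  by rewrite /geometric /= mul1r exprVn.
have cx : cvgn x.
  apply: cauchy_cvg; apply/cauchy_ballP => e e0.
  have [N _ HN] : \forall n \near \oo, 2 * C / 2 ^+ n < e / 2.
    have /cvgrPdist_lt := e2; move=> /(_ (e / 2)); rewrite divr_gt0// => /(_ isT).
    by apply: filterS => n; rewrite sub0r normrN; apply: le_lt_trans; exact: ler_norm.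
  exists (range (fun k => x (N + k)%N), range (fun k => x (N + k)%N)) => /=.
    by split; exists N => // n /= Nn; exists (n - N)%N => //; rewrite subnKC.
  move=> [_ _] [[k _ <-] [l _ <-]] /=; rewrite -ball_normE /=.
  rewrite (_ : x (N + k)%N - _ = (x (N + k)%N - x N) - (x (N + l)%N - x N)); last first.
    by rewrite opprB addrA subrK.
  apply: le_lt_trans (ler_normB _ _) _.
  rewrite [e]splitr; apply: ltrD; apply: le_lt_trans (Hk _ _) _; exact: HN (leqnn N).
exists (limn x) => n.
apply/ler_addgt0Pr => e e0.
have [N _ HN] : \forall m \near \oo, `|limn x - x m| < e by apply: cvgr_dist_lt.
have := HN (n + N)%N (leq_addl _ _) => /= He.
rewrite (_ : limn x - x n = (x (n + N)%N - x n) + (limn x - x (n + N)%N)).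
  by rewrite (le_trans (ler_normD _ _))// lerD// ltW.
by rewrite [RHS]addrC addrA subrK.
Unshelve. all: by end_near. Qed.

Lemma geometric_cauchy d (x : nat -> 'rV[R]_d) (C : R) :
  (forall n, `|x n.+1 - x n| <= C / 2 ^+ n) ->
  exists l, forall n, `|l - x n| <= 2 * C / 2 ^+ n.
Proof.
move=> H; have C0 : 0 <= C by have := H 0%N; rewrite expr0 divr1; apply: le_trans.
have /choice[l Hl] : forall j, exists l, forall n, `|l - x n ord0 j| <= 2 * C / 2 ^+ n.
  move=> j; apply: geometric_cauchy_real => n; apply: le_trans (H n).
  by have := row_norm_ge (x n.+1 - x n) j; rewrite !mxE.
exists (\row_j l j) => n; apply: row_norm_le.
  by rewrite divr_ge0// ?exprn_ge0// mulr_ge0.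
by move=> j; rewrite !mxE.
Qed.

End ODE.

Section Picard.
Context {R : realType}.

Lemma mean_value_ball (W : normedModType R) (G g : R -> W) (K t0 t : R) :
  (forall s, `|s - t0| <= `|t - t0| -> is_derive s 1 G (g s) /\ `|g s| <= K) ->
  `|G t - G t0| <= K * `|t - t0|.
Proof.
move=> H; have H' s : `|s - t0| <= `|t - t0| -> derivable G s 1 /\ `|'D_1 G s| <= K.
  by move=> /H[[dG ->]].
have [tt|tt] := leP t0 t.
  rewrite (ger0_norm (_ : 0 <= t - t0)) ?subr_ge0//.
  apply: mean_value_derive => // s /andP[s1 s2]; apply: H'.
  by rewrite !ger0_norm ?subr_ge0// lerD2r.
rewrite distrC (distrC t) (ger0_norm (_ : 0 <= t0 - t)); last by rewrite subr_ge0 ltW.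
apply: mean_value_derive => [|s /andP[s1 s2]]; first exact: ltW.
apply: H'; rewrite distrC (distrC t) !ger0_norm ?lerD2l ?lerN2 ?subr_ge0//.
exact: ltW.
Qed.

(** Picard iteration.  Boundedness and the Lipschitz condition are global in
    time and space, so that no invariant domain has to be tracked; on the ball
    of radius r each step halves the distance between two approximations. *)
Lemma picard_global d (F : R -> 'rV[R]_d -> 'rV[R]_d) (t0 : R) (y0 : 'rV[R]_d)
    (C L r : R) :
  continuous (fun z : R * 'rV[R]_d => F z.1 z.2) ->
  (forall t y, `|F t y| <= C) ->
  (forall t y y', `|F t y - F t y'| <= L * `|y - y'|) ->
  0 <= L -> 0 < r -> r < 1 -> r * L <= 2^-1 ->
  exists y : R -> 'rV[R]_d, y t0 = y0 /\ forall t, `|t - t0| <= r ->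
    is_derive t 1 y (F t (y t)) /\ `|y t - y0| <= C * `|t - t0|.
Proof.
move=> cF FC FL L0 r0 r1 rL.
have C0 : 0 <= C := le_trans (normr_ge0 _) (FC t0 y0).
have /choice[I HI] : forall g : R -> 'rV[R]_d, exists G : R -> 'rV[R]_d, continuous g ->
    [/\ G t0 = 0, continuous G & forall t, `|t - t0| < 1 -> is_derive t 1 G (g t)].
  move=> g; have [cg|ncg] := pselect (continuous g); last by exists g.
  by have [G HG] := antiderivative t0 cg; exists G.
have cFv v : continuous v -> continuous (fun s => F s (v s)).
  move=> cv t; apply: (@continuous_comp _ _ _ (fun s => (s, v s)) (fun z => F z.1 z.2)).
    by apply: (@pair_continuous _ _ _ id); [exact: cvg_id|exact: cv].
  exact: cF.
pose T (v : R -> 'rV[R]_d) := (fun t => y0 + I (fun s => F s (v s)) t).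
have T0 v : continuous v -> T v t0 = y0.
  by move=> cv; rewrite /T; have [-> _ _] := HI _ (cFv v cv); rewrite addr0.
have cT v : continuous v -> continuous (T v).
  move=> cv t; rewrite /T.
  by apply: (@cvgD _ _ _ _ _ (fun=> y0)); [exact: cvg_cst|have [_ + _] := HI _ (cFv v cv); exact].
have dT v t : continuous v -> `|t - t0| < 1 -> is_derive t 1 (T v) (F t (v t)).
  move=> cv t1; have [_ _ /(_ t t1) dI] := HI _ (cFv v cv).
  exact: is_derive_eq (is_deriveD (is_derive_cst y0 t 1) dI) (add0r _).
have Tcontr v w B t : continuous v -> continuous w -> `|t - t0| <= r ->
    (forall s, `|s - t0| <= r -> `|v s - w s| <= B) -> `|T v t - T w t| <= B / 2.
  move=> cv cw tr vwB.
  have := @mean_value_ball _ (T v - T w) (fun s => F s (v s) - F s (w s)) (L * B) t0 t.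
  have B0 : 0 <= B := le_trans (normr_ge0 _) (vwB t tr).
  rewrite /= !fctE !T0// subrr subr0 => /(_ _)/le_trans; apply.
    move=> s st; have sr := le_trans st tr.
    split; first by apply: is_deriveB; apply: dT => //; exact: le_lt_trans sr r1.
    by apply: le_trans (FL _ _ _) _; rewrite ler_wpM2l// vwB.
  rewrite mulrAC mulrC ler_wpM2l//; apply: le_trans rL.
  by rewrite mulrC ler_wpM2r.
have Tlip v t s : continuous v -> `|t - t0| <= r -> `|s - t0| <= r ->
    `|T v t - T v s| <= C * `|t - s|.
  move=> cv; wlog st : s t / s <= t.
    by move=> H tr sr; have [/H/(_ tr sr)//|/ltW/H/(_ sr tr)] := leP s t; rewrite distrC (distrC s).
  move=> tr sr; rewrite (ger0_norm (_ : 0 <= t - s)) ?subr_ge0//.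
  apply: mean_value_derive => // x /andP[sx xt].
  have [|dTx ->] := dT v x cv; last by split=> //; exact: FC.
  apply: le_lt_trans r1; move: tr sr; rewrite !ler_norml; lra.
pose u n := iter n T (fun=> y0).
have c0 : continuous (fun _ : R => y0) by exact: cst_continuous.
have cu n : continuous (u n) by elim: n => [|n IH]; [exact: c0|exact: cT].
have uB n t : `|t - t0| <= r -> `|u n.+1 t - u n t| <= C / 2 ^+ n.
  elim: n t => [|n IH] t tr.
    
    have := Tlip _ t t0 c0 tr; rewrite T0// subrr normr0 expr0 divr1 => /(_ (ltW r0)).
    by move/le_trans; apply; rewrite ler_piMr// (le_trans tr)// ltW.
  by rewrite exprSr invfM mulrA; exact: (Tcontr _ _ _ _ (cu n.+1) (cu n) tr IH).
have /choice[y Hy] : forall t, exists l, `|t - t0| <= r ->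
    forall n, `|l - u n t| <= 2 * C / 2 ^+ n.
  move=> t; have [tr|] := leP `|t - t0| r; last by exists 0.
  by have [l ul] := @geometric_cauchy R d (u ^~ t) C (fun n => uB n t tr); exists l.
(* The uniform bounds on the iterates are passed to the limit through this fact. *)
have half0 (x : R) : (forall n, x <= 4 * C / 2 ^+ n) -> x <= 0.
  move=> H; have : (fun n => 4 * C / 2 ^+ n) @ \oo --> (4 * C * 0 : R).
    apply: cvgMr; under eq_fun do rewrite -exprVn.
    by apply: cvg_expr; rewrite ger0_norm ?invr_ge0// invf_lt1 ?ltr0n// ltr1n.
  rewrite mulr0 => /cvgrPdist_lt cv0; apply/ler_addgt0Pr => e e0.
  have [N _ HN] := cv0 e e0; have := HN N (leqnn N); rewrite /= sub0r normrN add0r => HNe.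
  by rewrite (le_trans (H N))// (le_trans (ler_norm _))// ltW.
(* The limit is only controlled on the ball; clamping the time makes it a
   continuous function on the line, to which the integral operator applies. *)
pose z t := y (clampR t0 r t).
have zy t : `|t - t0| <= r -> z t = y t by move=> tr; rewrite /z clampR_id.
have clr t : `|clampR t0 r t - t0| <= r by exact/clampR_dist/ltW.
have cz : continuous z.
  apply: (@lipschitz_continuous _ _ _ _ C) => t s.
  apply: (@le_trans _ _ (C * `|clampR t0 r t - clampR t0 r s|)); last first.
    by rewrite ler_wpM2l// clampR_lip.
  rewrite -subr_le0; apply: half0 => n; rewrite lerBlDr.
  set a := clampR _ _ _; set b := clampR _ _ _.
  have -> : z t - z s = (y a - u n.+1 a) + ((u n.+1 a - u n.+1 b) + (u n.+1 b - y b)).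
    by rewrite /z -/a -/b !subrKA.
  have uab := Tlip (u n) a b (cu n) (clr t) (clr s).
  have ya := Hy a (clr t) n.+1; have := Hy b (clr s) n.+1; rewrite distrC => yb.
  apply: le_trans (ler_normD _ _) _; apply: le_trans (lerD ya (ler_normD _ _)) _.
  apply: le_trans (lerD (lexx _) (lerD uab yb)) _.
  rewrite exprS invfM (_ : 2 * C * (2^-1 / 2 ^+ n) = C / 2 ^+ n); last first.
    by rewrite mulrACA divff ?mul1r// pnatr_eq0.
  have h : 0 <= C / 2 ^+ n by rewrite divr_ge0// exprn_ge0.
  by rewrite -!(mulrA 4); lra.
have Tz t : `|t - t0| <= r -> T z t = z t.
  move=> tr; apply/eqP; rewrite -subr_eq0 -normr_le0; apply: half0 => n.
  rewrite -(subrKA (u n.+1 t)); apply: le_trans (ler_normD _ _) _.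
  have : `|T z t - u n.+1 t| <= (2 * C / 2 ^+ n) / 2.
    by apply: Tcontr => // s sr; rewrite zy//; exact: Hy.
  rewrite (distrC (u n.+1 t)) zy// => h1; have := lerD h1 (Hy t tr n.+1).
  move/le_trans; apply; rewrite exprSr invfM mulrA -mulrDr.
  have h : 0 <= C / 2 ^+ n by rewrite divr_ge0// exprn_ge0.
  rewrite -!mulrA; lra.
(* The fixed point z is differentiable because T z is. *)
exists (T z); split; first exact: T0.
move=> t tr; split.
  by rewrite Tz//; apply: dT => //; exact: le_lt_trans tr r1.
by rewrite -{1}(T0 z cz); apply: Tlip => //; rewrite subrr normr0 ltW.
Qed.

End Picard.

Section LocalFlow.
Context {R : realType}.

Lemma smooth_on_differentiable (V W : normedModType R) (U : set V) (f : V -> W) x :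
  smooth_on U f -> U x -> differentiable f x.
Proof. by move=> sf Ux; have [/(_ x Ux)] := sf 1%N. Qed.

Lemma smooth_on_derive (V W : normedModType R) (U : set V) (f : V -> W) v :
  smooth_on U f -> smooth_on U ('D_v f).
Proof. by move=> sf k; have [_ /(_ v)] := sf k.+1. Qed.

Lemma smooth_on_continuous (V W : normedModType R) (U : set V) (f : V -> W) x :
  smooth_on U f -> U x -> {for x, continuous f}.
Proof. by move=> sf Ux; exact: (sf 0%N). Qed.

(** Since y' = f (t, y), the derivative of y is as regular as y itself, hence y
    is one degree more regular than it is known to be. *)
Lemma ode_bootstrap d (f : R * 'rV[R]_d -> 'rV[R]_d) (D : set (R * 'rV[R]_d))
    (U : set R) (y : R -> 'rV[R]_d) : open U -> smooth_on D f ->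
  (forall t, U t -> D (t, y t) /\ is_derive t 1 y (f (t, y t))) -> smooth_on U y.
Proof.
move=> oU sf H; have dy t : U t -> differentiable y t.
  by move=> /H[_ [dy _]]; exact/derivable1_diffP.
elim=> [|k IH] /=; first by move=> t /dy/differentiable_continuous.
split=> [//|v].
apply: (@Ck_eq _ _ _ k U (fun t => v *: f (t, y t))) => // [t Ut|].
  have [_ [_ <-]] := H t Ut; rewrite !(deriveE _ (dy t Ut)) -linearZ.
  by rewrite /GRing.scale /= mulr1.
apply: Ck_scale => //; first exact: Ck_cst.
apply: (@Ck_comp _ _ _ _ k U D (fun t => (t, y t)) f) => //.
- by apply: findim_prod; [exact: findim_real|exact: findim_rV].
- by move=> t /H[].
- by apply: Ck_pair => //; exact: smooth_on_id.
Qed.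

Definition clampV d (c : 'rV[R]_d) (r : R) (y : 'rV[R]_d) : 'rV[R]_d :=
  \row_j clampR (c ord0 j) r (y ord0 j).

Lemma clampV_dist d (c : 'rV[R]_d) r y : 0 <= r -> `|clampV c r y - c| <= r.
Proof. by move=> r0; apply: row_norm_le => // j; rewrite !mxE; exact: clampR_dist. Qed.

Lemma clampV_id d (c : 'rV[R]_d) r y : `|y - c| <= r -> clampV c r y = y.
Proof.
move=> yr; apply/rowP => j; rewrite mxE clampR_id//; apply: le_trans yr.
by have := row_norm_ge (y - c) j; rewrite !mxE.
Qed.

Lemma clampV_lip d (c : 'rV[R]_d) r y z : `|clampV c r y - clampV c r z| <= `|y - z|.
Proof.
apply: row_norm_le => // j; rewrite !mxE; apply: le_trans (clampR_lip _ _ _ _) _.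
by have := row_norm_ge (y - z) j; rewrite !mxE.
Qed.

(** Mean value inequality along the segment from b to a, which stays in the box
    by convexity.  The factor d counts the partial derivatives into which the
    derivative in the direction a - b is expanded. *)
Lemma box_lipschitz d (f : R * 'rV[R]_d -> 'rV[R]_d) (t r K : R) (y0 : 'rV[R]_d) :
  (forall y, `|y - y0| <= r -> differentiable f (t, y) /\
     forall j, `|'D_(0, delta_mx ord0 j) f (t, y)| <= K) ->
  forall a b, `|a - y0| <= r -> `|b - y0| <= r ->
    `|f (t, a) - f (t, b)| <= K *+ d * `|a - b|.
Proof.
move=> H a b ar br.
pose phi s := (t, b + s *: (a - b)) : R * 'rV[R]_d.
have phir s : 0 <= s <= 1 -> `|b + s *: (a - b) - y0| <= r.
  move=> /andP[s0 s1].
  rewrite (_ : b + s *: (a - b) - y0 = (1 - s) *: (b - y0) + s *: (a - y0)).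
    apply: le_trans (ler_normD _ _) _; rewrite !normrZ ger0_norm ?subr_ge0// ger0_norm//.
    have h1 : (1 - s) * `|b - y0| <= (1 - s) * r by rewrite ler_wpM2l// subr_ge0.
    have h2 : s * `|a - y0| <= s * r by rewrite ler_wpM2l.
    lra.
  by apply/rowP => j; rewrite !mxE; ring.
have dphi s : differentiable phi s /\ 'D_1 phi s = (0, a - b).
  have d2 : is_derive s (1 : R) (fun s => b + s *: (a - b)) (a - b).
    have did : differentiable (@idfun R : R -> R) s by exact: ex_diff.
    have dl : differentiable (fun s : R => s *: (a - b)) s.
      by exact: (@differentiableZl _ _ _ id).
    have dE : 'D_1 (fun s : R => s *: (a - b)) s = a - b.
      rewrite (@derive_scale _ _ _ id (cst (a - b))) ?derive_id//.
      by rewrite derive_cst scaler0 add0r scale1r.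
    have d1 : is_derive s (1 : R) (fun s : R => s *: (a - b)) (a - b).
      by split=> //; exact: diff_derivable.
    exact: is_derive_eq (is_deriveD (is_derive_cst b s 1) d1) (add0r _).
  have df2 : differentiable (fun s : R => b + s *: (a - b)) s.
    by apply/derivable1_diffP; have [] := d2.
  have dc : differentiable (fun _ : R => t) s by exact: differentiable_cst.
  split; first exact: differentiable_pair.
  rewrite (@derive_pair _ _ _ _ (fun=> t) (fun s : R => b + s *: (a - b)))//.
  by rewrite derive_cst; have [_ ->] := d2.
have := @mean_value_derive R _ (f \o phi) (K *+ d * `|a - b|) 0 1.
rewrite /= /phi scale0r addr0 scale1r (addrC b) subrK subr0 mulr1; apply=> // s s01.
have [dfs KD] := H _ (phir s s01); have [ds1 ds2] := dphi s.
split; first exact/diff_derivable/differentiable_comp.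
rewrite (derive_comp _ ds1 dfs) ds2.
have -> : (0, a - b) = \sum_j (a - b) ord0 j *: (0 : R, delta_mx ord0 j : 'rV[R]_d).
  rewrite {1}(row_sum_delta (a - b)).
  rewrite (big_morph (fun x : 'rV[R]_d => (0 : R, x)) (id1 := 0) (op1 := +%R)) //.
    by apply: eq_bigr => i _; congr (_, _); rewrite /= scaler0.
  by move=> x y; congr (_, _); rewrite addr0.
rewrite linear_sum; apply: le_trans (ler_norm_sum _ _ _) _.
have -> : K *+ d * `|a - b| = \sum_(j < d) `|a - b| * K.
  by rewrite sumr_const card_ord mulrnAl mulrC.
apply: ler_sum => j _; rewrite linearZ normrZ -deriveE//.
apply: ler_pM => //; exact: row_norm_ge.
Qed.

(** The theorem of Picard and Lindelof for smooth fields.  The field is clamped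
    to a box around (t0, y0) on which it is bounded and Lipschitz; a solution
    of the clamped equation cannot leave the box in a short time, and inside the
    box clamping changes nothing. *)
Theorem ode_local_solution d (f : R * 'rV[R]_d -> 'rV[R]_d)
    (D : set (R * 'rV[R]_d)) (t0 : R) (y0 : 'rV[R]_d) :
  open D -> D (t0, y0) -> smooth_on D f ->
  exists2 r, 0 < r & exists y : R -> 'rV[R]_d, [/\ y t0 = y0,
    forall t, `|t - t0| < r -> D (t, y t) /\ is_derive t 1 y (f (t, y t)) &
    smooth_on [set t | `|t - t0| < r] y].
Proof.
move=> oD D0 sf.
pose Dj j := 'D_(0, delta_mx ord0 j : 'rV[R]_d) f.
pose C := `|f (t0, y0)| + 1.
pose K := \sum_j (`|Dj j (t0, y0)| + 1).
have bnd (g : R * 'rV[R]_d -> 'rV[R]_d) : smooth_on D g ->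
    \forall z \near (t0, y0), `|g z| <= `|g (t0, y0)| + 1.
  move=> sg; have /cvgr_dist_le := smooth_on_continuous sg D0; move=> /(_ 1 ltr01).
  apply: filterS => z gz; rewrite -{1}(subrK (g (t0, y0)) (g z)).
  by rewrite (le_trans (ler_normD _ _))// addrC lerD2l distrC.
have [r r0 Hr] : exists2 r, 0 < r & forall t y, `|t - t0| <= r -> `|y - y0| <= r ->
    [/\ D (t, y), `|f (t, y)| <= C & forall j, `|Dj j (t, y)| <= K].
  have : nbhs (t0, y0) (fun z => [/\ D z, `|f z| <= C & forall j, `|Dj j z| <= K]).
    have h1 : \forall z \near (t0, y0), D z by exact: open_nbhs_nbhs.
    have h3 : \forall z \near (t0, y0), forall j, `|Dj j z| <= `|Dj j (t0, y0)| + 1.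
      apply: (@filter_forall _ 'I_d (fun j z => `|Dj j z| <= `|Dj j (t0, y0)| + 1)
        _ (nbhs_filter _)) => j.
      by apply: bnd; exact: smooth_on_derive.
    apply: filterS3 h1 (bnd f sf) h3 => z Dz fz Dfz; split=> // j.
    rewrite (le_trans (Dfz j))// /K (bigD1 j)//= lerDl.
    by apply: sumr_ge0 => i _; exact: addr_ge0.
  move=> /nbhs_ballP[e /= e0 He]; exists (e / 2); first exact: divr_gt0.
  have e2 : e / 2 < e by rewrite ltr_pdivrMr// ltr_pMr// ltr1n.
  move=> t y te ye; apply: (He (t, y)); split; rewrite -ball_normE /ball_ /= distrC.
    exact: le_lt_trans te e2.
  exact: le_lt_trans ye e2.
have C0 : 0 < C by rewrite ltr_wpDl.
have K0 : 0 <= K by apply: sumr_ge0 => j _; rewrite addr_ge0.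
pose F t y := f (clampR t0 r t, clampV y0 r y).
have inbox t y : [/\ D (clampR t0 r t, clampV y0 r y),
    `|F t y| <= C & forall j, `|Dj j (clampR t0 r t, clampV y0 r y)| <= K].
  by apply: Hr; [exact/clampR_dist/ltW|exact/clampV_dist/ltW].
have cF : continuous (fun z : R * 'rV[R]_d => F z.1 z.2).
  move=> z; apply: (@continuous_comp _ _ _ (fun z => (clampR t0 r z.1, clampV y0 r z.2)) f).
    apply: prod_fun_continuous.
      by apply: (@lipschitz_continuous _ _ _ (clampR t0 r) 1) => x y; rewrite mul1r clampR_lip.
    by apply: (@lipschitz_continuous _ _ _ (clampV y0 r) 1) => x y; rewrite mul1r clampV_lip.
  by apply: (smooth_on_continuous sf); have [] := inbox z.1 z.2.
have FC t y : `|F t y| <= C by have [] := inbox t y.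
have FL t y y' : `|F t y - F t y'| <= K *+ d * `|y - y'|.
  apply: (@le_trans _ _ (K *+ d * `|clampV y0 r y - clampV y0 r y'|)).
    apply: (@box_lipschitz d f (clampR t0 r t) r K y0); rewrite ?clampV_dist ?ltW//.
    move=> x xr; have [Dx _ Kx] := Hr _ _ (clampR_dist t0 t (ltW r0)) xr.
    by split=> //; exact: smooth_on_differentiable sf Dx.
  by rewrite ler_wpM2l ?mulrn_wge0// clampV_lip.
pose L := K *+ d.
have L0 : 0 <= L by rewrite mulrn_wge0.
(* The first two bounds keep the solution in the box, 2^-1 keeps the times in the
   domain of the antiderivatives, the last one makes the iteration contract. *)
pose e := Num.min (Num.min r (r / C)) (Num.min 2^-1 (2^-1 / (L + 1))).
have L1 : 0 < L + 1 by rewrite ltr_wpDl.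
have e0 : 0 < e by rewrite !lt_min r0 divr_gt0// invr_gt0 ltr0n /= divr_gt0// invr_gt0 ltr0n.
have er : e <= r by rewrite /e !ge_min lexx.
have erC : e * C <= r by rewrite -ler_pdivlMr// /e !ge_min lexx orbT.
have e1 : e < 1 by rewrite /e !gt_min invf_lt1 ?ltr0n// ltr1n orbT.
have eL : e * L <= 2^-1.
  have : e <= 2^-1 / (L + 1) by rewrite /e !ge_min lexx !orbT.
  rewrite ler_pdivlMr// => h; apply: le_trans h; by rewrite mulrDr mulr1 lerDl ltW.
have [y [yt0 Hy]] := picard_global t0 y0 cF FC FL L0 e0 e1 eL.
have sol t : `|t - t0| < e -> D (t, y t) /\ is_derive t 1 y (f (t, y t)).
  move=> /ltW te; have [dy yC] := Hy t te.
  have tr := le_trans te er.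
  have yr : `|y t - y0| <= r.
    by rewrite (le_trans yC)// (le_trans _ erC)// mulrC ler_wpM2r// ltW.
  have [? _ _] := Hr _ _ tr yr; split=> //.
  by move: dy; rewrite /F clampR_id// clampV_id.
exists e => //; exists y; split=> //.
apply: (ode_bootstrap _ sf) => //.
rewrite (_ : [set t | _] = ball t0 e); first exact: ball_open.
by apply/seteqP; split => t; rewrite /ball /= distrC.
Qed.

End LocalFlow.

(** * Velocities of curves in manifolds *)

Section Velocities.
Context {R : realType}.
Implicit Types (V W X : normedModType R).

(** The chain rule for difference quotients that converge along an arbitrary
    filter at 0, as the quotients of a one-sided curve do. *)
Lemma derive_along V W (F : V -> W) (u0 v : V) (u : R -> V) (G : set_system R) :
  Filter G -> differentiable F u0 -> G --> (0 : R) -> (\forall s \near G, s != 0) ->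
  s^-1 *: (u s - u0) @[s --> G] --> v ->
  s^-1 *: (F (u s) - F u0) @[s --> G] --> 'd F u0 v.
Proof.
move=> FG dF G0 Gn0 qv; pose q s := s^-1 *: (u s - u0).
have uq : \forall s \near G, u s - u0 = s *: q s.
  by apply: filterS Gn0 => s s0; rewrite /q scalerA divff// scale1r.
have u0c : u s - u0 @[s --> G] --> (0 : V).
  rewrite -(scale0r v); have : s *: q s @[s --> G] --> 0 *: v.
    by apply: (@cvgZ _ _ _ _ FG id q); [exact: G0|exact: qv].
  by apply: cvg_trans; apply: near_eq_cvg; apply: filterS uq => s ->.
have qb : \forall s \near G, `|q s| <= `|v| + 1.
  move/cvgr_dist_le : qv => /(_ 1 ltr01); apply: filterS => s.
  rewrite -/(q s) distrC => h; rewrite -{1}(subrK v (q s)).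
  by rewrite (le_trans (ler_normD _ _))// addrC lerD2l.
have dc : 'd F u0 (q s) @[s --> G] --> 'd F u0 v.
  by apply: (@cvg_comp _ _ _ q ('d F u0)); [exact: qv|exact: diff_continuous].
apply/cvgrPdist_le => e e0.
have v1 : 0 < `|v| + 1 by rewrite ltr_wpDl.
have e2 : 0 < e / 2 by rewrite divr_gt0.
have /diff_locallyP[_ /eqaddoP /(_ _ (divr_gt0 e2 v1)) Ho] := dF.
have Hu : \forall s \near G, `|F (u s) - F u0 - 'd F u0 (u s - u0)| <=
    e / 2 / (`|v| + 1) * `|u s - u0|.
  have := u0c _ Ho; apply: (@filterS _ G FG) => s /=.
  by rewrite !fctE /= subrK opprD addrA.
move/cvgr_dist_le : dc => /(_ _ e2) dc.
near=> s.
have s0 : s != 0 by near: s.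
have us : u s - u0 = s *: q s by near: s.
have -> : s^-1 *: (F (u s) - F u0) =
    'd F u0 (q s) + s^-1 *: (F (u s) - F u0 - 'd F u0 (u s - u0)).
  have dq : 'd F u0 (s *: q s) = s *: 'd F u0 (q s) by exact: linearZ.
  by rewrite us dq [s^-1 *: (_ - _ *: _)]scalerBr scalerA mulVf// scale1r [RHS]addrC subrK.
rewrite opprD addrA [e]splitr.
apply: le_trans (ler_normB _ _) _; apply: lerD; first by near: s.
rewrite normrZ normfV ler_pdivrMl ?normr_gt0//.
apply: (@le_trans _ _ (e / 2 / (`|v| + 1) * `|u s - u0|)); first by near: s.
rewrite us normrZ mulrCA ler_wpM2l// mulrAC ler_pdivrMr// ler_pM2l//.
by near: s.
Unshelve. all: by end_near. Qed.

Lemma within_neq0 (J : set R) : \forall s \near within J (0 : R)^', s != 0.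
Proof.
have n1 : \forall s \near (0 : R)^', s != 0 by exact: nbhs_dnbhs_neq.
exact: (@cvg_within _ (0 : R)^' _ J _ n1).
Qed.

Lemma within_dnbhs (J B : set R) :
  within J (nbhs (0 : R)) B -> within J (0 : R)^' B.
Proof. by move=> H; exact: (@cvg_within _ (nbhs (0 : R)) _ _ _ H). Qed.

Section Def.
Context {V W : normedModType R} {M : manifold V} {N : manifold W}.

(** Continuity is part of the notion: the local representative says nothing
    about f once f leaves the chart at f x. *)
Definition mdiff (f : M -> N) (x : M) : Prop :=
  {for x, continuous f} /\
  differentiable (local_rep f x) (chart_coord (mchart x) x).

Lemma msmooth_mdiff (U : set M) (f : M -> N) x : msmooth_on U f -> U x -> mdiff f x.
Proof.
move=> sf Ux; have [cf [D [_ Dx] sD]] := sf x Ux; split=> //.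
exact: smooth_on_differentiable sD Dx.
Qed.

Lemma tmapD (f : M -> N) x u v : tmap f x (u + v) = tmap f x u + tmap f x v.
Proof. by rewrite /tmap linearD. Qed.

Lemma tmap0 (f : M -> N) x : tmap f x 0 = 0.
Proof. by rewrite /tmap linear0. Qed.

End Def.

Lemma velocity_sub V (M : manifold V) (J J' : set R) (c : R -> M) v :
  J' `<=` J -> has_velocity J c v -> has_velocity J' c v.
Proof.
move=> JJ [cc cv]; split.
  by apply: cvg_trans cc; apply: cvg_app; apply: within_subset.
by apply: cvg_trans cv; apply: cvg_app; apply: within_subset.
Qed.

Lemma velocity_eq V (M : manifold V) (J : set R) (c c' : R -> M) v : J 0 ->
  (\forall s \near within J (nbhs (0 : R)), c s = c' s) ->
  has_velocity J c v -> has_velocity J c' v.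
Proof.
move=> J0 E [cc cv].
have E0 : c 0 = c' 0 by exact: (nbhs_singleton E) J0.
split.
  rewrite -E0; apply: cvg_trans cc; apply: near_eq_cvg.
  by apply: filterS E => s ->.
apply: cvg_trans cv; apply: near_eq_cvg.
rewrite -E0; apply: filterS (within_dnbhs E) => s ->.
by [].
Qed.

(** 0 is an accumulation point of the domain of a curve, which is why velocities
    are unique. *)
Lemma curve_domain_proper (J : set R) : curve_domain J ->
  ProperFilter (within J (0 : R)^').
Proof.
move=> [Ji J0 [s Js s0]].
apply: Build_ProperFilter_ex => B; rewrite /within /= => /nbhs_ballP[e /= e0 He].
pose k := Num.min 1 (e / (2 * `|s|)).
have sp : 0 < `|s| by rewrite normr_gt0.
have k0 : 0 < k by rewrite lt_min ltr01 divr_gt0// mulr_gt0.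
have k1 : k <= 1 by rewrite ge_min lexx.
have ks0 : k * s != 0 by rewrite mulf_neq0// gt_eqF.
have Jk : J (k * s).
  have [s1|s1] := leP 0 s.
    by apply: (Ji 0 s) => //; rewrite mulr_ge0 ?(ltW k0)//= ler_piMl.
  apply: (Ji s 0) => //; rewrite (mulr_ge0_le0 (ltW k0) (ltW s1)) andbT.
  by rewrite -subr_ge0 -{2}(mul1r s) -mulrBl mulr_le0// ?subr_le0// ltW.
exists (k * s); apply: (He (k * s)) => //.
rewrite /ball /= sub0r normrN normrM (gtr0_norm k0).
apply: (@le_lt_trans _ _ (e / (2 * `|s|) * `|s|)).
  by rewrite ler_wpM2r// ge_min lexx orbT.
by rewrite invfM mulrA -mulrA mulVf ?gt_eqF// mulr1 ltr_pdivrMr// ltr_pMr// ltr1n.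
Qed.

Lemma velocity_unique V (M : manifold V) (J : set R) (c : R -> M) v w :
  curve_domain J -> has_velocity J c v -> has_velocity J c w -> v = w.
Proof.
move=> /curve_domain_proper PF [_ cv] [_ cw].
exact: (cvg_unique (@norm_hausdorff _ V) cv cw).
Qed.

Lemma velocity_comp V W (M : manifold V) (N : manifold W) (J : set R) (c : R -> M)
    (f : M -> N) v :
  mdiff f (c 0) -> has_velocity J c v -> has_velocity J (f \o c) (tmap f (c 0) v).
Proof.
move=> [cf df] [cc cv]; split.
  by apply: cvg_comp cc _; exact: cf.
have nd : \forall s \near within J (0 : R)^', chart_dom (mchart (c 0)) (c s).
  apply: within_dnbhs; apply: cc; apply: open_nbhs_nbhs.
  by split; [exact: chart_dom_open|exact: mchart_dom].
have d0 : within J (0 : R)^' --> (0 : R).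
  move=> B B0; apply: (@cvg_within _ (0 : R)^' _ J).
  exact: (@cvg_within _ (nbhs (0 : R)) _ _ B B0).
have n0 := within_neq0 J.
have FF : Filter (within J (0 : R)^') by exact: within_filter.
have := derive_along FF df d0 n0 cv.
apply: cvg_trans; apply: near_eq_cvg; apply: filterS nd => s ds.
by rewrite /local_rep /= !chart_coordK//; exact: mchart_dom.
Qed.

End Velocities.

(** * Smooth maps between manifolds *)

Section SmoothManifoldMaps.
Context {R : realType}.

Lemma continuous_within_at (T : topologicalType) (J : set R) (f : R -> T) (x : R) :
  {for x, continuous f} -> f @ within J (nbhs x) --> f x.
Proof. by move=> cf; apply: cvg_trans cf; apply: cvg_app; exact: cvg_within. Qed.

Section Comp.
Context {V W X : normedModType R} {M : manifold V} {N : manifold W} {L : manifold X}.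

Lemma local_rep_comp_near (f : M -> N) (g : N -> L) (x : M) (u : V) :
  chart_dom (mchart (f x)) (f (chart_param (mchart x) u)) ->
  local_rep g (f x) (local_rep f x u) = local_rep (g \o f) x u.
Proof. by move=> d; rewrite /local_rep /= chart_coordK. Qed.

Lemma near_chart_dom (f : M -> N) (x : M) : {for x, continuous f} ->
  \forall u \near chart_coord (mchart x) x,
    chart_dom (mchart (f x)) (f (chart_param (mchart x) u)).
Proof.
move=> cf; have xd := mchart_dom x.
have cfp : {for chart_coord (mchart x) x, continuous (f \o chart_param (mchart x))}.
  apply: continuous_comp; first exact/param_continuous/coord_cod.
  by rewrite chart_coordK.
apply: cfp; rewrite /= chart_coordK//; apply: open_nbhs_nbhs.
by split; [exact: chart_dom_open|exact: mchart_dom].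
Qed.

Lemma mdiff_comp (f : M -> N) (g : N -> L) (x : M) :
  mdiff f x -> mdiff g (f x) -> mdiff (g \o f) x.
Proof.
move=> [cf df] [cg dg]; split; first exact: continuous_comp.
have xd := mchart_dom x.
apply: (@differentiable_near_eq _ _ _ (local_rep g (f x) \o local_rep f x)).
  by apply: filterS (near_chart_dom cf) => u; exact: local_rep_comp_near.
apply: differentiable_comp => //.
by rewrite /local_rep /= chart_coordK.
Qed.

Lemma tmap_comp (f : M -> N) (g : N -> L) (x : M) v :
  mdiff f x -> mdiff g (f x) -> tmap (g \o f) x v = tmap g (f x) (tmap f x v).
Proof.
move=> [cf df] [cg dg]; have xd := mchart_dom x.
have fx : local_rep f x (chart_coord (mchart x) x) = chart_coord (mchart (f x)) (f x).
  by rewrite /local_rep /= chart_coordK.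
rewrite /tmap -(deriveE _ (mdiff_comp (conj cf df) (conj cg dg)).2).
have -> : 'D_v (local_rep (g \o f) x) (chart_coord (mchart x) x) =
    'D_v (local_rep g (f x) \o local_rep f x) (chart_coord (mchart x) x).
  apply: near_eq_derive.
  by apply: filterS (near_chart_dom cf) => u du; rewrite /= local_rep_comp_near.
by rewrite derive_comp ?fx// deriveE.
Qed.

(** The openness of U makes f continuous at the points near x, which keeps f in
    the domain of the chart at f x on a whole neighbourhood. *)
Lemma msmooth_comp (U : set M) (U' : set N) (f : M -> N) (g : N -> L) :
  findim W -> open U -> (forall x, U x -> U' (f x)) ->
  msmooth_on U f -> msmooth_on U' g -> msmooth_on U (g \o f).
Proof.
move=> fW oU UU' sf sg x Ux.
have [cf [Df [oDf Dfx] sF]] := sf x Ux.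
have [cg [Dg [oDg Dgx] sG]] := sg _ (UU' x Ux).
have xd := mchart_dom x.
split; first exact: continuous_comp.
pose D := [set u | [/\ chart_cod (mchart x) u, U (chart_param (mchart x) u), Df u,
  Dg (local_rep f x u) & chart_dom (mchart (f x)) (f (chart_param (mchart x) u))]].
have oD : open D.
  rewrite openE => u [cu Uu Du Gu du].
  have cp := param_continuous cu.
  have h1 := open_nbhs_nbhs (conj (chart_cod_open (mchart x)) cu).
  have h2 : \forall w \near u, U (chart_param (mchart x) w).
    by apply: cp; exact: open_nbhs_nbhs.
  have h3 := open_nbhs_nbhs (conj oDf Du).
  have h4 : \forall w \near u, Dg (local_rep f x w).
    have := smooth_on_continuous sF Du; apply; exact: open_nbhs_nbhs.
  have cfp : {for u, continuous (f \o chart_param (mchart x))}.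
    by apply: continuous_comp => //; have [] := sf _ Uu.
  have h5 : \forall w \near u, chart_dom (mchart (f x)) (f (chart_param (mchart x) w)).
    by apply: cfp; apply: open_nbhs_nbhs; split=> //; exact: chart_dom_open.
  have nI := @filterI _ _ (nbhs_filter u).
  apply: (@filterS _ _ (nbhs_filter u) _ _ _ (nI _ _ (nI _ _ h1 h2) (nI _ _ h3 (nI _ _ h4 h5)))).
  by move=> w [[? ?] [? [? ?]]].
exists D.
  split=> //; split; rewrite /local_rep /= ?chart_coordK//.
    exact: coord_cod.
  exact: mchart_dom.
have Dg' u : D u -> Dg (local_rep f x u) by case.
have sF' : smooth_on D (local_rep f x).
  by move=> k; apply: Ck_sub (sF k) => u [].
have := smooth_on_comp fW oD Dg' sF' sG.
move=> H k; apply: Ck_eq (H k) => // u [_ _ _ _ du] /=.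
exact: local_rep_comp_near.
Qed.

End Comp.

Section Basic.
Context {V W X : normedModType R} {M : manifold V} {N : manifold W} {L : manifold X}.

Lemma msmooth_sub (U U' : set M) (f : M -> N) :
  U' `<=` U -> msmooth_on U f -> msmooth_on U' f.
Proof. by move=> UU sf x /UU; exact: sf. Qed.

Lemma msmooth_id (U : set M) : msmooth_on U (id : M -> M).
Proof.
move=> x Ux; split; first exact: cvg_id.
exists (chart_cod (mchart x)).
  by split; [exact: chart_cod_open|exact/coord_cod/mchart_dom].
move=> k; apply: (@Ck_eq _ _ _ k _ id); first exact: chart_cod_open.
  by move=> u cu; rewrite /local_rep /= chart_paramK.
exact: smooth_on_id.
Qed.

Lemma msmooth_cst (U : set M) (y : N) : msmooth_on U (fun=> y).
Proof.
move=> x Ux; split; first exact: cvg_cst.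
by exists setT; [split; [exact: openT|]|move=> k; exact: Ck_cst].
Qed.

Lemma mdiff_id (x : M) : mdiff (id : M -> M) x.
Proof. exact: (@msmooth_mdiff _ _ _ _ _ setT _ _ (@msmooth_id _)). Qed.

Lemma mdiff_cst (y : N) (x : M) : mdiff (fun=> y) x.
Proof. exact: (@msmooth_mdiff _ _ _ _ _ setT _ _ (@msmooth_cst _ _)). Qed.

Lemma mdiff_pair (f : L -> M) (g : L -> N) x : mdiff f x -> mdiff g x ->
  mdiff (N := prod_manifold M N) (fun z => (f z, g z)) x.
Proof.
move=> [cf df] [cg dg]; split; first exact: pair_continuous.
exact: (differentiable_pair df dg).
Qed.

Lemma msmooth_pair (U : set L) (f : L -> M) (g : L -> N) :
  msmooth_on U f -> msmooth_on U g ->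
  msmooth_on (N := prod_manifold M N) U (fun z => (f z, g z)).
Proof.
move=> sf sg x Ux.
have [cf [Df [oDf Dfx] sF]] := sf x Ux.
have [cg [Dg [oDg Dgx] sG]] := sg x Ux.
split; first exact: pair_continuous.
have oD : open (Df `&` Dg) by exact: openI.
exists (Df `&` Dg); first by [].
move=> k; apply: (@Ck_pair _ _ _ _ k _ (local_rep f x) (local_rep g x)) => //.
  by apply: Ck_sub (sF k) => u [].
by apply: Ck_sub (sG k) => u [].
Qed.

Lemma msmooth_coord (x : M) :
  msmooth_on (N := vmanifold V) (chart_dom (mchart x)) (chart_coord (mchart x)).
Proof.
move=> y dy; split; first exact: (Defs.coord_continuous dy).
exists (chart_cod (mchart y) `&` chart_param (mchart y) @^-1` chart_dom (mchart x)).
  split; first exact: chart_overlap_open.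
  split; first exact/coord_cod/mchart_dom.
  by rewrite /= chart_coordK//; exact: mchart_dom.
exact: mchart_compat.
Qed.

Lemma msmooth_param (x : M) :
  msmooth_on (M := vmanifold V) (chart_cod (mchart x)) (chart_param (mchart x)).
Proof.
move=> u cu; split; first exact: param_continuous.
exists (chart_cod (mchart x) `&` chart_param (mchart x) @^-1`
          chart_dom (mchart (chart_param (mchart x) u))).
  split; first exact: chart_overlap_open.
  by split=> //; exact: mchart_dom.
exact: mchart_compat.
Qed.

Lemma velocity_pair (J : set R) (c : R -> M) (c' : R -> N) v v' :
  has_velocity J c v -> has_velocity J c' v' ->
  has_velocity (M := prod_manifold M N) J (fun s => (c s, c' s)) (v, v').
Proof.
move=> [cc cv] [cc' cv']; split.
  by apply: cvg_pair; [exact: cc|exact: cc'].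
by apply: (cvg_pair cv cv').
Qed.

Lemma velocity_cst (J : set R) (x : M) : has_velocity J (fun=> x) 0.
Proof.
split; first exact: cvg_cst.
under eq_fun do rewrite subrr scaler0; exact: cvg_cst.
Qed.

Lemma curve_domainT : curve_domain [set: R].
Proof. by split=> //; exists 1 => //; rewrite oner_neq0. Qed.

Lemma chart_line0 (x : M) (v : V) :
  chart_param (mchart x) (chart_coord (mchart x) x + 0 *: v) = x.
Proof. by rewrite scale0r addr0 chart_coordK//; exact: mchart_dom. Qed.

(** Every tangent vector is the velocity of a straight line in the chart.
    Identities between tangent maps can therefore be proved by computing the
    velocity of one curve in two ways. *)
Lemma velocity_chart_line (x : M) (v : V) : has_velocity setT
  (fun s => chart_param (mchart x) (chart_coord (mchart x) x + s *: v)) v.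
Proof.
pose u (s : R) := chart_coord (mchart x) x + s *: v.
have u0 : u 0 = chart_coord (mchart x) x by rewrite /u scale0r addr0.
pose c s := chart_param (mchart x) (u s).
have c0 : c 0 = x by exact: chart_line0.
have cu : continuous u.
  apply: (@lipschitz_continuous _ _ _ _ `|v|) => a b.
  by rewrite /u opprD addrACA subrr add0r -scalerBl normrZ mulrC.
have cod0 : chart_cod (mchart x) (u 0) by rewrite u0; exact/coord_cod/mchart_dom.
rewrite -/c; split.
  apply: continuous_within_at.
  apply: (@continuous_comp _ _ _ u); [exact: cu|exact: param_continuous].
have nc : \forall s \near within setT (0 : R)^', chart_cod (mchart x) (u s).
  have nc0 : \forall s \near (0 : R), chart_cod (mchart x) (u s).
    by apply: cu; apply: open_nbhs_nbhs; split=> //; exact: chart_cod_open.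
  apply: (@cvg_within _ (0 : R)^' _ setT).
  exact: (@cvg_within _ (nbhs (0 : R)) _ _ _ nc0).
have ns := @within_neq0 R setT.
apply: (@cvg_trans _ ((fun=> v) @ within setT (0 : R)^')); last exact: cvg_cst.
apply: near_eq_cvg; apply: filterS2 nc ns => s cs s0.
by rewrite c0 /c chart_paramK// /u [X in _ *: X]addrC addKr scalerA mulVf// scale1r.
Qed.

Lemma velocity_exists (x : M) (v : V) :
  exists2 c : R -> M, c 0 = x & has_velocity setT c v.
Proof. by exists (fun s => chart_param (mchart x) (chart_coord (mchart x) x + s *: v));
  [exact: chart_line0|exact: velocity_chart_line]. Qed.

End Basic.

Lemma continuous_translate (t : R) : continuous (fun s : R => t + s).
Proof.
apply: (@lipschitz_continuous _ _ _ _ 1) => a b.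
by rewrite opprD addrACA subrr add0r mul1r.
Qed.

Lemma velocity_derive (V : normedModType R) (J : set R) (y : R -> V) (t : R) (v : V) :
  is_derive t 1 y v ->
  has_velocity (M := vmanifold V) J (fun s => y (t + s)) v.
Proof.
move=> [dy yv].
have vt : has_velocity (M := vmanifold R) setT (fun s => t + s) 1.
  split.
    apply: (@continuous_within_at R); exact: continuous_translate.
  apply: (@cvg_trans _ ((fun=> 1) @ within setT (0 : R)^')); last exact: cvg_cst.
  apply: near_eq_cvg.
  have ns := @within_neq0 R setT.
  apply: filterS ns => s s0.
  by rewrite /= addr0 addrC addKr /GRing.scale /= mulVf.
have dfy : differentiable y t by exact/derivable1_diffP.
have my : mdiff (M := vmanifold R) (N := vmanifold V) y t.
  by split=> //; exact: differentiable_continuous.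
have := @velocity_comp _ _ _ (vmanifold R) (vmanifold V) setT (fun s => t + s) y 1.
rewrite /= addr0 => /(_ my vt).
rewrite (_ : tmap _ _ _ = v); last by rewrite -yv deriveE.
by move=> H; exact: velocity_sub H.
Qed.

Lemma velocity_smooth (V : normedModType R) (M : manifold V) (U : set (vmanifold R))
    (l : vmanifold R -> M) (J : set R) (t : R) :
  msmooth_on U l -> U t ->
  has_velocity J (fun s => l (t + s)) (tmap l t 1).
Proof.
move=> sl Ut; have ml := msmooth_mdiff sl Ut.
have vt : has_velocity (M := vmanifold R) J (fun s => t + s) 1.
  by apply: (@velocity_derive _ J id).
have := @velocity_comp _ _ _ (vmanifold R) M J (fun s => t + s) l 1.
by rewrite addr0; apply.
Qed.

(** The velocity is the one of any smooth extension across the boundary of S. *)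
Lemma velocity_smooth_within (V : normedModType R) (M : manifold V) (S : set R)
    (l : R -> M) (J : set R) (t : R) :
  smooth_within S l -> J 0 -> (forall s, J s -> S (t + s)) ->
  exists v, has_velocity J (fun s => l (t + s)) v.
Proof.
move=> sl J0 JS; have St : S t by have := JS 0 J0; rewrite addr0.
have [U [g [[oU Ut] sg lg]]] := sl t St.
exists (tmap g t 1).
apply: velocity_eq (velocity_smooth J sg Ut) => //.
have nU : \forall s \near (0 : R), U (t + s).
  by apply: (@continuous_translate t); rewrite /= addr0; exact: open_nbhs_nbhs.
by rewrite near_withinE; apply: filterS nU => s Us Js; rewrite lg//; exact: JS.
Qed.

Lemma smooth_on_msmooth (V W : normedModType R) (U : set V) (y : V -> W) :
  open U -> smooth_on U y -> msmooth_on (M := vmanifold V) (N := vmanifold W) U y.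
Proof.
move=> oU sy x Ux; split; first exact: smooth_on_continuous sy Ux.
by exists U.
Qed.

End SmoothManifoldMaps.

(** * Tangent maps, Lie groups and principal actions *)

Section TangentMaps.
Context {R : realType} {V W X : normedModType R}
  {M : manifold V} {N : manifold W} {L : manifold X}.

Lemma tmap_id (x : M) v : tmap (id : M -> M) x v = v.
Proof.
have [c c0 cv] := velocity_exists x v.
have := velocity_comp (mdiff_id (c 0)) cv; rewrite c0 => cv'.
exact: (velocity_unique (@curve_domainT R) cv' cv).
Qed.

Lemma tmap_cst (y : N) (x : M) v : tmap (fun=> y) x v = 0.
Proof.
have [c c0 cv] := velocity_exists x v.
have := velocity_comp (mdiff_cst y (c 0)) cv; rewrite c0 => cv'.
exact: (velocity_unique (@curve_domainT R) cv' (velocity_cst _ y)).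
Qed.

Lemma tmap_pair (f : L -> M) (g : L -> N) x v : mdiff f x -> mdiff g x ->
  tmap (N := prod_manifold M N) (fun z => (f z, g z)) x v = (tmap f x v, tmap g x v).
Proof.
move=> mf mg; have [c c0 cv] := velocity_exists x v.
have mp := mdiff_pair mf mg; move: mf mg mp; rewrite -c0 => mf mg mp.
have c1 := velocity_comp mp cv.
have c2 := velocity_pair (velocity_comp mf cv) (velocity_comp mg cv).
exact: (velocity_unique (@curve_domainT R) c1 c2).
Qed.

End TangentMaps.

Section LieGroupCalculus.
Context {R : realType} {VG : normedModType R} {G : lieGroup VG}.
Implicit Types g h x : G.

Lemma gmulKg h x : gmul (ginv h) (gmul h x) = x.
Proof. by rewrite gmulA gmulVg gmul1g. Qed.

Lemma gmulVKg h x : gmul h (gmul (ginv h) x) = x.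
Proof. by rewrite gmulA gmulgV gmul1g. Qed.

Lemma gmulgK h x : gmul (gmul x h) (ginv h) = x.
Proof. by rewrite -gmulA gmulgV gmulg1. Qed.

Lemma gmulgI h x y : gmul h x = gmul h y -> x = y.
Proof. by move=> E; rewrite -(gmulKg h x) E gmulKg. Qed.

Lemma ginvK h : ginv (ginv h) = h.
Proof. by rewrite -[LHS](gmulg1) -(gmulVg h) gmulA gmulVg gmul1g. Qed.

Lemma mdiff_gmul (z : prod_manifold G G) :
  mdiff (fun z : prod_manifold G G => gmul z.1 z.2) z.
Proof. exact: (msmooth_mdiff (@gmul_smooth _ _ G) (I : setT z)). Qed.

Lemma mdiff_ginv x : mdiff (fun x : G => ginv x) x.
Proof. exact: (msmooth_mdiff (@ginv_smooth _ _ G) (I : setT x)). Qed.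

Lemma mdiff_lmul h x : mdiff (fun g : G => gmul h g) x.
Proof.
exact: (mdiff_comp (mdiff_pair (mdiff_cst h x) (mdiff_id x)) (mdiff_gmul _)).
Qed.

Lemma mdiff_rmul h x : mdiff (fun g : G => gmul g h) x.
Proof.
exact: (mdiff_comp (mdiff_pair (mdiff_id x) (mdiff_cst h x)) (mdiff_gmul _)).
Qed.

Lemma tmap_lmulK h x v :
  tmap (fun g : G => gmul (ginv h) g) (gmul h x) (tmap (fun g : G => gmul h g) x v) = v.
Proof.
rewrite -(tmap_comp v (mdiff_lmul h x) (mdiff_lmul (ginv h) _)).
have -> : (fun g : G => gmul (ginv h) g) \o (fun g : G => gmul h g) = id.
  by apply/funext => g; rewrite /= gmulKg.
exact: tmap_id.
Qed.

Lemma tmap_rmulK h x v :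
  tmap (fun g : G => gmul g (ginv h)) (gmul x h) (tmap (fun g : G => gmul g h) x v) = v.
Proof.
rewrite -(tmap_comp v (mdiff_rmul h x) (mdiff_rmul (ginv h) _)).
have -> : (fun g : G => gmul g (ginv h)) \o (fun g : G => gmul g h) = id.
  by apply/funext => g; rewrite /= gmulgK.
exact: tmap_id.
Qed.

Lemma tmap_lmulVK h v :
  tmap (fun g : G => gmul h g) (gone G) (tmap (fun g : G => gmul (ginv h) g) h v) = v.
Proof.
by have := tmap_lmulK (ginv h) h v; rewrite ginvK gmulVg.
Qed.

Lemma tmap_lmul_inj h : injective (tmap (fun g : G => gmul h g) (gone G)).
Proof. by move=> u v E; rewrite -(tmap_lmulK h (gone G) u) E tmap_lmulK. Qed.

Lemma tmap_rmul_inj h : injective (tmap (fun g : G => gmul g h) (gone G)).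
Proof. by move=> u v E; rewrite -(tmap_rmulK h (gone G) u) E tmap_rmulK. Qed.

(** The identity h (h^-1 x h) = x h, differentiated at x = 1. *)
Lemma tmap_lmul_Ad h v :
  tmap (fun g : G => gmul h g) (gone G) (Ad (ginv h) v) =
  tmap (fun g : G => gmul g h) (gone G) v.
Proof.
rewrite /Ad ginvK.
have fE : gmul (gmul (ginv h) (gone G)) h = gone G by rewrite gmulg1 gmulVg.
have mf : mdiff (fun x : G => gmul (gmul (ginv h) x) h) (gone G).
  exact: (mdiff_comp (mdiff_lmul (ginv h) (gone G)) (mdiff_rmul h _)).
have ml : mdiff (fun g : G => gmul h g) (gmul (gmul (ginv h) (gone G)) h).
  exact: mdiff_lmul.
have := tmap_comp v mf ml; rewrite fE => <-.
by congr (tmap _ _ _); apply/funext => x; rewrite /= gmulA gmulVKg.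
Qed.

Lemma Ad0 h : Ad h (0 : VG) = 0.
Proof. exact: tmap0. Qed.

End LieGroupCalculus.

Section BundleCalculus.
Context {R : realType} {VG VM VP : normedModType R} {G : lieGroup VG}
  {M : manifold VM} {P : principalBundle G M VP}.
Implicit Types (p q : P) (g h : G).

Lemma act_free p g h : act p g = act p h -> g = h.
Proof.
have [U [tau [sigma [[_ Up] _ _ [_ _ taua]]]]] := local_triviality P (bproj p).
by move=> /(congr1 tau); rewrite !taua//; exact: gmulgI.
Qed.

Lemma act_transitive p q : bproj p = bproj q -> exists g, q = act p g.
Proof.
have [U [tau [sigma [[_ Up] _ _ [_ st taua]]]]] := local_triviality P (bproj p).
move=> pq; exists (gmul (ginv (tau p)) (tau q)).
have Uq : U (bproj q) by rewrite -pq.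
set g := gmul _ _; have Ug : U (bproj (act p g)) by rewrite bproj_act.
by rewrite -(st q Uq) -(st _ Ug) bproj_act -pq taua// gmulVKg.
Qed.

Lemma actK p g : act (act p g) (ginv g) = p.
Proof. by rewrite actM gmulgV act1. Qed.

Lemma actVK p g : act (act p (ginv g)) g = p.
Proof. by rewrite actM gmulVg act1. Qed.

Lemma mdiff_act (z : prod_manifold P G) :
  mdiff (fun z : prod_manifold P G => act z.1 z.2) z.
Proof. exact: (msmooth_mdiff (@act_smooth _ _ _ _ _ _ P) (I : setT z)). Qed.

Lemma mdiff_ract g p : mdiff (fun p : P => act p g) p.
Proof.
exact: (mdiff_comp (mdiff_pair (mdiff_id p) (mdiff_cst g p)) (mdiff_act _)).
Qed.

Lemma mdiff_orbit p g : mdiff (fun g : G => act p g) g.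
Proof.
exact: (mdiff_comp (mdiff_pair (mdiff_cst p g) (mdiff_id g)) (mdiff_act _)).
Qed.

(** A tangent vector of a product is the sum of its two partial components. *)
Lemma tmap_act p g v w :
  tmap (fun z : prod_manifold P G => act z.1 z.2) (p, g) (v, w) =
  tmap (fun p : P => act p g) p v + tmap (fun g : G => act p g) g w.
Proof.
have -> : (v, w) = (v, 0) + (0, w) by congr (_, _); rewrite /= ?addr0 ?add0r.
rewrite tmapD; congr (_ + _).
  have E := tmap_comp v (mdiff_pair (mdiff_id p) (mdiff_cst g p)) (mdiff_act (p, g)).
  transitivity (tmap (fun z : prod_manifold P G => act z.1 z.2) (p, g)
    (tmap (N := prod_manifold P G) (fun z => (z, g)) p v)); last by rewrite -E.
  by rewrite (tmap_pair _ (mdiff_id p) (mdiff_cst g p)) tmap_id tmap_cst.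
have E := tmap_comp w (mdiff_pair (mdiff_cst p g) (mdiff_id g)) (mdiff_act (p, g)).
transitivity (tmap (fun z : prod_manifold P G => act z.1 z.2) (p, g)
  (tmap (N := prod_manifold P G) (fun z => (p, z)) g w)); last by rewrite -E.
by rewrite (tmap_pair _ (mdiff_cst p g) (mdiff_id g)) tmap_id tmap_cst.
Qed.

(** The Leibniz rule for the principal action.  The velocity of q h is the sum
    of R_h q' and of q h'; equivariance and verticality of A turn this into
    A ((q h)') = Ad (h^-1) (A q') + h^-1 h'.  Multiplying by h on the left
    removes Ad. *)
Lemma velocity_act (A : connection P) (J : set R) (q : R -> P) (h : R -> G) X T :
  has_velocity J q X -> has_velocity J h T ->
  exists2 Y, has_velocity J (fun s => act (q s) (h s)) Y &
    tmap (fun g : G => gmul (h 0) g) (gone G) (A (act (q 0) (h 0)) Y) =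
    T + tmap (fun g : G => gmul g (h 0)) (gone G) (A (q 0) X).
Proof.
move=> qX hT.
exists (tmap (fun z : prod_manifold P G => act z.1 z.2) (q 0, h 0) (X, T)).
  exact: (velocity_comp (mdiff_act (q 0, h 0)) (velocity_pair qX hT)).
rewrite tmap_act linearD conn_equiv /= tmapD tmap_lmul_Ad addrC; congr (_ + _).
set xi := tmap (fun g : G => gmul (ginv (h 0)) g) (h 0) T.
have -> : tmap (fun g : G => act (q 0) g) (h 0) T =
          tmap (fun g : G => act (act (q 0) (h 0)) g) (gone G) xi.
  have := tmap_comp xi (mdiff_lmul (h 0) (gone G)) (mdiff_orbit (q 0) (gmul (h 0) (gone G))).
  rewrite /xi tmap_lmulVK gmulg1 => <-.
  by congr (tmap _ _ _); apply/funext => g; rewrite /= actM.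
by rewrite conn_vertical tmap_lmulVK.
Qed.

(** In a local trivialization tau the quotient is h = tau(q)^-1 tau(q'), a smooth
    expression in q and q'. *)
Lemma velocity_quotient (J : set R) (q q' : R -> P) (h : R -> G) X X' : J 0 ->
  has_velocity J q X -> has_velocity J q' X' ->
  (forall s, J s -> q' s = act (q s) (h s)) -> exists T, has_velocity J h T.
Proof.
move=> J0 qX qX' E.
have [U [tau [sigma [[oU Uq] st _ [_ _ taua]]]]] := local_triviality P (bproj (q 0)).
have mt := msmooth_mdiff st Uq.
have Uq' : U (bproj (q' 0)) by rewrite E// bproj_act.
have mt' := msmooth_mdiff st Uq'.
have v1 := velocity_comp mt qX; have v2 := velocity_comp mt' qX'.
have v3 := velocity_comp (mdiff_ginv _) v1.
have v4 := velocity_comp (mdiff_gmul _) (velocity_pair v3 v2).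
eexists; apply: velocity_eq v4 => //.
have Uc : \forall s \near within J (nbhs (0 : R)), U (bproj (q s)).
  have [cq _] := qX.
  have cb : {for q 0, continuous (fun p : P => bproj p)}.
    by have [] := msmooth_mdiff (@bproj_smooth _ _ _ _ _ _ P) (I : setT (q 0)).
  have Uc0 : nbhs (q 0) (fun p : P => U (bproj p)).
    by apply: cb; exact: open_nbhs_nbhs.
  exact: (cq _ Uc0).
rewrite near_withinE; rewrite near_withinE in Uc.
by apply: filterS Uc => s Us Js /=; rewrite E// taua ?gmulKg//; exact: Us.
Qed.

End BundleCalculus.

(** * Local horizontal lifts *)

Section LocalLift.
Context {R : realType} {d n k : nat} {G : lieGroup 'rV[R]_d} {M : manifold 'rV[R]_n}
  {P : principalBundle G M 'rV[R]_k}.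
Variable A : connection P.

Let e0 := chart_coord (mchart (gone G)) (gone G).
Let param := chart_param (mchart (gone G)).

Let chart_mul (z : 'rV[R]_d * 'rV[R]_d) : 'rV[R]_d :=
  chart_coord (mchart (gone G)) (gmul (param z.1) (param z.2)).

Lemma mul_chart_smooth : exists2 D : set ('rV[R]_d * 'rV[R]_d),
  open D /\ D (e0, e0) & smooth_on D chart_mul.
Proof.
have [_ [D [oD D0] sD]] := @gmul_smooth _ _ G (gone G, gone G) I.
by exists D => //; move: sD; rewrite /local_rep /= gmul1g.
Qed.

(** Both sides are the velocity of s |-> c(s) g, where g has coordinates y and
    c(s) has coordinates e0 + s a: on the left it is computed in G, on the right
    through the chart at the unit. *)
Lemma tmap_rmul_chart (a y : 'rV[R]_d) : chart_cod (mchart (gone G)) y ->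
  differentiable chart_mul (e0, y) ->
  tmap (fun g : G => gmul g (param y)) (gone G) a =
  tmap (M := vmanifold 'rV[R]_d) param y ('D_(a, 0) chart_mul (e0, y)).
Proof.
move=> cy dm.
pose c s := param (e0 + s *: a).
have c0 : c 0 = gone G by exact: chart_line0.
have cv : has_velocity setT c a by exact: velocity_chart_line.
have v1 : has_velocity setT (fun s => gmul (c s) (param y))
    (tmap (fun g : G => gmul g (param y)) (gone G) a).
  by rewrite -c0; exact: (velocity_comp (mdiff_rmul (param y) (c 0)) cv).
pose eta (s : R) := chart_mul (e0 + s *: a, y).
have eta0 : eta 0 = y.
  by rewrite /eta /chart_mul /= -/(c 0) c0 gmul1g chart_paramK.
have deta : is_derive (0 : R) 1 eta ('D_(a, 0) chart_mul (e0, y)).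
  pose phi (s : R) := (e0, y) + s *: (a, 0 : 'rV[R]_d).
  have phi0 : phi 0 = (e0, y) by rewrite /phi scale0r addr0.
  have dlin : is_derive (0 : R) 1 (fun s : R => s *: (a, 0 : 'rV[R]_d)) (a, 0).
    have did : differentiable (@idfun R : R -> R) (0 : R) by exact: ex_diff.
    split; first by apply: diff_derivable; exact: (@differentiableZl _ _ _ id).
    rewrite (@derive_scale _ _ _ id (cst (a, 0 : 'rV[R]_d))) ?derive_id//.
    by rewrite derive_cst scaler0 add0r scale1r.
  have dphi : is_derive (0 : R) 1 phi (a, 0).
    exact: is_derive_eq (is_deriveD (is_derive_cst (e0, y) (0 : R) 1) dlin) (add0r _).
  have dfphi : differentiable phi 0 by apply/derivable1_diffP; have [] := dphi.
  have -> : eta = chart_mul \o phi.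
    apply/funext => s; rewrite /eta /phi /=; congr chart_mul; congr (_, _).
    by rewrite /= scaler0 addr0.
  have dm' : differentiable chart_mul (phi 0) by rewrite phi0.
  split; first by apply: diff_derivable; exact: differentiable_comp.
  by rewrite derive_comp//; have [_ ->] := dphi; rewrite phi0 -deriveE.
have v2 : has_velocity setT (fun s => param (eta s))
    (tmap (M := vmanifold 'rV[R]_d) param y ('D_(a, 0) chart_mul (e0, y))).
  have := velocity_derive setT deta.
  rewrite (_ : (fun s => eta (0 + s)) = eta); last by apply/funext => s; rewrite add0r.
  move=> ve; rewrite -{1}eta0; apply: (velocity_comp _ ve).
  by apply: (msmooth_mdiff (@msmooth_param _ _ _ _)); rewrite eta0.
apply: (velocity_unique (@curve_domainT R) v1); apply: velocity_eq v2 => //.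
have : \forall s \near within setT (nbhs (0 : R)),
    chart_dom (mchart (gone G)) (gmul (c s) (param y)).
  have [cc _] := v1; apply: cc; apply: open_nbhs_nbhs; split; first exact: chart_dom_open.
  by rewrite c0 gmul1g; exact: param_dom.
by apply: filterS => s ds; rewrite /eta /chart_mul /param chart_coordK.
Qed.

Lemma local_section (U : set (vmanifold R)) (g : vmanifold R -> M) (t0 : R) :
  open U -> U t0 -> msmooth_on U g ->
  exists (U1 : set (vmanifold R)) (b : vmanifold R -> P),
    [/\ open U1, U1 t0, U1 `<=` U, msmooth_on U1 b & forall t, U1 t -> bproj (b t) = g t].
Proof.
move=> oU Ut sg.
have [Ub [tau [sigma [[oUb Ubt] _ ss [st _ _]]]]] := local_triviality P (g t0).
pose U1 : set (vmanifold R) := [set t | U t /\ Ub (g t)].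
have oU1 : open U1.
  rewrite openE => t [Ut' Ubt'].
  apply: (@filterS _ _ (nbhs_filter t) _ _ _
    (@filterI _ _ (nbhs_filter t) U (g @^-1` Ub) _ _)) => //.
    exact: open_nbhs_nbhs.
  by have [cg _] := sg t Ut'; apply: cg; exact: open_nbhs_nbhs.
exists U1, (fun t => sigma (g t, gone G)); split=> //; first by move=> t [].
  apply: (@msmooth_comp _ _ _ _ _ (prod_manifold M G) _ U1 (Ub `*` setT)
    (fun t => (g t, gone G)) sigma) => //.
  - by apply: findim_prod; exact: findim_rV.
  - by move=> t [].
  - apply: msmooth_pair; last exact: msmooth_cst.
    by apply: msmooth_sub sg => t [].
by move=> t [_ Ubt']; have [] := st _ (gone G) Ubt'.
Qed.

(** Tangent vectors are read in preferred charts, which jump from point to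
    point, so the smoothness in t of A on the velocity of b is not visible
    directly.  In the single chart at b t0 the connection has smooth
    coefficients omega, and A is their combination with the coordinates of the
    derivative of beta. *)
Lemma connection_along_smooth (U1 : set (vmanifold R)) (b : vmanifold R -> P) (t0 : R) :
  open U1 -> U1 t0 -> msmooth_on U1 b ->
  exists (N : set R) (a : R -> 'rV[R]_d),
    [/\ open N, N t0, N `<=` U1, smooth_on N a & forall t, N t -> A (b t) (tmap b t 1) = a t].
Proof.
move=> oU1 U1t sb.
pose p0 := b t0.
pose beta (t : R) := chart_coord (mchart p0) (b t).
have [cb0 [D [oD Dt] sbeta]] := sb t0 U1t.
have {}sbeta : smooth_on D beta by [].
pose N : set R := [set t | [/\ D t, U1 t & chart_dom (mchart p0) (b t)]].
have oN : open N.
  rewrite openE => t [Dt' U1t' dt].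
  have [cb _] := sb t U1t'.
  have h1 : nbhs t D by exact: open_nbhs_nbhs.
  have h2 : nbhs t U1 by exact: open_nbhs_nbhs.
  have h3 : nbhs t [set t | chart_dom (mchart p0) (b t)].
    by apply: cb; apply: open_nbhs_nbhs; split=> //; exact: chart_dom_open.
  have nI := @filterI _ _ (nbhs_filter t).
  by apply: (@filterS _ _ (nbhs_filter t) _ _ _ (nI _ _ h1 (nI _ _ h2 h3))) => s [? []].
have [r [e [c ec]]] := @findim_rV R k.
pose omega v (u : 'rV[R]_k) := let p := chart_param (mchart p0) u in
  A p ('d (chart_coord (mchart p) \o chart_param (mchart p0)) u v).
have somega v : smooth_on (chart_cod (mchart p0)) (omega v) := conn_smooth A p0 v.
pose a t := \sum_i c i ('D_1 beta t) *: omega (e i) (beta t).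
have sbN : smooth_on N beta by move=> j; apply: Ck_sub (sbeta j) => t [].
exists N, a; split=> //.
- by split=> //; exact: mchart_dom.
- by move=> t [].
- move=> j; apply: Ck_sum => // i; apply: Ck_scale => //.
    apply: (@Ck_linear_comp _ _ _ _ j N (c i) ('D_1 beta)) => //; first exact: ec.1.
    exact: (@smooth_on_derive R _ _ N beta 1 sbN j).
  apply: (@Ck_comp _ _ _ _ j N (chart_cod (mchart p0)) beta (omega (e i))) => //.
  + exact: findim_rV.
  + by move=> t [_ _ dt]; exact: coord_cod.
  + exact: somega.
move=> t [Dt' U1t' dt].
have dbeta : differentiable beta t := smooth_on_differentiable sbeta Dt'.
have ct : chart_cod (mchart p0) (beta t) by exact: coord_cod.
have v1 := velocity_smooth setT sb U1t'.
have vb : has_velocity (M := vmanifold 'rV[R]_k) setT (fun s => beta (t + s)) ('D_1 beta t).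
  by apply: velocity_derive; split=> //; exact: diff_derivable.
have v2 : has_velocity setT (fun s => chart_param (mchart p0) (beta (t + s)))
    (tmap (M := vmanifold 'rV[R]_k) (chart_param (mchart p0)) (beta t) ('D_1 beta t)).
  have mp : mdiff (M := vmanifold 'rV[R]_k) (chart_param (mchart p0)) (beta (t + 0)).
    by apply: (msmooth_mdiff (@msmooth_param _ _ _ _)); rewrite addr0.
  have := velocity_comp mp vb; by rewrite /comp addr0.
have E : tmap b t 1 =
    tmap (M := vmanifold 'rV[R]_k) (chart_param (mchart p0)) (beta t) ('D_1 beta t).
  apply: (velocity_unique (@curve_domainT R) v1); apply: velocity_eq v2 => //.
  have : \forall s \near within setT (nbhs (0 : R)), chart_dom (mchart p0) (b (t + s)).
    have [cc _] := v1; apply: cc; rewrite addr0; apply: open_nbhs_nbhs.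
    by split=> //; exact: chart_dom_open.
  by apply: filterS => s ds; rewrite /beta chart_coordK.
have pt : chart_param (mchart p0) (beta t) = b t by rewrite /beta chart_coordK.
have lin (p : P) (l : {linear 'rV[R]_k -> 'rV[R]_k}) v :
    A p (l v) = \sum_i c i v *: A p (l (e i)).
  rewrite {1}(ec.2 v) !linear_sum; apply: eq_bigr => i _.
  have -> : l (c i v *: e i) = c i v *: l (e i) by exact: linearZ.
  exact: linearZ.
rewrite E -[in LHS]pt /tmap /a.
exact: lin.
Qed.

(** Let b be any lift of g and look for a horizontal one of the form b h.  By
    [velocity_act] b h is horizontal if and only if h' + R_h a = 0 where
    a = A (b').  In the chart at the unit of G this is the equation
    y' = - D_(a, 0) chart_mul (e0, y), whose right-hand side is smooth, and h
    may start at the unit. *)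
Theorem local_horizontal_lift (U : set (vmanifold R)) (g : vmanifold R -> M) (t0 : R) :
  open U -> U t0 -> msmooth_on U g ->
  exists (U' : set (vmanifold R)) (l : vmanifold R -> P),
    [/\ open U', U' t0, msmooth_on U' l &
      forall t, U' t -> bproj (l t) = g t /\ A (l t) (tmap l t 1) = 0].
Proof.
move=> oU Ut sg.
have [U1 [b [oU1 U1t U1U sb bg]]] := local_section oU Ut sg.
have [N [a [oN Nt NU1 sa aE]]] := connection_along_smooth oU1 U1t sb.
have [D [oD D0] sm] := mul_chart_smooth.
have [r [e [c ec]]] := @findim_rV R d.
pose f (z : R * 'rV[R]_d) : 'rV[R]_d :=
  \sum_j (- c j (a z.1)) *: 'D_(e j, 0) chart_mul (e0, z.2).
pose DD : set (R * 'rV[R]_d) := [set z | [/\ N z.1, D (e0, z.2) &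
  chart_cod (mchart (gone G)) z.2]].
have cpair (y : 'rV[R]_d) : {for y, continuous (fun y : 'rV[R]_d => (e0, y))}.
  by apply: (@pair_continuous _ _ _ (fun=> e0) id); [exact: cst_continuous|exact: cvg_id].
have oDD : open DD.
  have o1 : open [set y : 'rV[R]_d | D (e0, y) /\ chart_cod (mchart (gone G)) y].
    apply: openI; last exact: chart_cod_open.
    by apply: (@open_comp _ _ (fun y => (e0, y)) D) => // y _; exact: cpair.
  have := prod_open oN o1; congr open; apply/seteqP; split => z /=.
    by move=> [? []].
  by move=> [? ? ?].
have DD0 : DD (t0, e0) by split=> //=; exact/coord_cod/mchart_dom.
have fw : findim (R * 'rV[R]_d)%type.
  by apply: findim_prod; [exact: findim_real|exact: findim_rV].
have sf : smooth_on DD f.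
  move=> j; apply: Ck_sum => // i; apply: Ck_scale => //.
    have lc : Ck j N (fun t => - c i (a t)).
      rewrite (_ : (fun t => _) = (fun t => (-1 : R) *: c i (a t))); last first.
        by apply/funext => t; rewrite scaleN1r.
      apply: Ck_scale => //; first exact: Ck_cst.
      exact: (@Ck_linear_comp _ _ _ _ j N (c i) a oN (ec.1 i) (sa j)).
    apply: (@Ck_comp _ _ _ _ j DD N fst (fun t => - c i (a t))) => //.
    + exact: findim_real.
    + by move=> z [].
    + exact: Ck_fst.
  apply: (@Ck_comp _ _ _ _ j DD D (fun z => (e0, z.2)) ('D_(e i, 0) chart_mul)) => //.
  - by apply: findim_prod; exact: findim_rV.
  - by move=> z [].
  - by apply: Ck_pair => //; [exact: Ck_cst|exact: Ck_snd].
  - exact: (@smooth_on_derive R _ _ D chart_mul _ sm j).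
have [rho rho0 [y [yt0 Hy sy]]] := ode_local_solution oDD DD0 sf.
pose U' : set (vmanifold R) := [set t | `|t - t0| < rho].
have oU' : open U'.
  rewrite (_ : U' = ball t0 rho); first exact: ball_open.
  by apply/seteqP; split => t; rewrite /U' /ball /= distrC.
have U'N t : U' t -> N t by move=> /Hy[[]].
have U'cod t : U' t -> chart_cod (mchart (gone G)) (y t) by move=> /Hy[[]].
pose h t := param (y t).
pose l (t : vmanifold R) : P := act (b t) (h t).
have sh : msmooth_on (M := vmanifold R) U' h.
  apply: (@msmooth_comp _ _ _ _ (vmanifold R) (vmanifold 'rV[R]_d) G U'
    (chart_cod (mchart (gone G))) y param) => //.
  - exact: findim_rV.
  - exact: smooth_on_msmooth.
  - exact: msmooth_param.
have sl : msmooth_on U' l.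
  apply: (@msmooth_comp _ _ _ _ (vmanifold R) (prod_manifold P G) P U' setT
    (fun t => (b t, h t)) (fun z => act z.1 z.2)) => //.
  - by apply: findim_prod; exact: findim_rV.
  - by apply: msmooth_pair => //; apply: msmooth_sub sb => t /U'N/NU1.
  - exact: act_smooth.
exists U', l; split=> //; first by rewrite /U' /= subrr normr0.
move=> t U't; have Ntt := U'N t U't; have [DDt dy] := Hy t U't.
split; first by rewrite /l bproj_act bg//; exact: NU1.
have vb := velocity_smooth setT sb (NU1 _ Ntt).
have vy := velocity_derive setT dy.
have mp : mdiff (M := vmanifold 'rV[R]_d) param (y (t + 0)).
  by apply: (msmooth_mdiff (@msmooth_param _ _ _ _)); rewrite addr0; exact: U'cod.
have vh := velocity_comp mp vy.
have [Y vY LY] := velocity_act A vb vh.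
rewrite (velocity_unique (@curve_domainT R) (velocity_smooth setT sl U't) vY).
move: LY; rewrite /comp !addr0 aE// => LY.
apply: (@tmap_lmul_inj _ _ _ (h t)); rewrite tmap0 LY.
have [_ Dy cy] := DDt.
rewrite (tmap_rmul_chart _ cy) -?tmapD; last exact: smooth_on_differentiable sm Dy.
rewrite (_ : f _ + _ = 0) ?tmap0//.
have dm : differentiable chart_mul (e0, y t) := smooth_on_differentiable sm Dy.
rewrite /f /= deriveE// {2}(ec.2 (a t)).
rewrite (_ : (\sum_j c j (a t) *: e j, 0) = \sum_j c j (a t) *: (e j, 0 : 'rV[R]_d)).
  rewrite linear_sum -big_split big1//= => j _.
  by rewrite linearZ -deriveE// scaleNr addNr.
rewrite (big_morph (fun x : 'rV[R]_d => (x, 0 : 'rV[R]_d)) (id1 := 0) (op1 := +%R)) //.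
  by apply: eq_bigr => i _; congr (_, _); rewrite /= scaler0.
by move=> x z; congr (_, _); rewrite addr0.
Qed.

End LocalLift.

(** * One-sided velocities *)

Section OneSided.
Context {R : realType}.

Definition seg (s : R) : set R := [set x | 0 <= x <= s \/ s <= x <= 0].

Lemma curve_domain_seg s : s != 0 -> curve_domain (seg s).
Proof.
move=> s0; split.
- move=> x y [/andP[x1 x2]|/andP[x1 x2]] [/andP[y1 y2]|/andP[y1 y2]] z /andP[z1 z2].
  + by left; rewrite (le_trans x1 z1) (le_trans z2 y2).
  + have sn : 0 <= s by exact: le_trans x1 x2.
    by left; rewrite (le_trans x1 z1)/= (le_trans z2)// (le_trans y2).
  + have [h|h] := leP 0 z; first by left; rewrite h (le_trans z2 y2).
    by right; rewrite (le_trans x1 z1) ltW.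
  + by right; rewrite (le_trans x1 z1) (le_trans z2 y2).
- by have [h|h] := leP 0 s; [left; rewrite lexx|right; rewrite lexx ltW].
- by exists s => //; have [h|h] := leP 0 s; [left; rewrite h lexx|right; rewrite lexx ltW].
Qed.

Lemma seg_sub (J : set R) s : curve_domain J -> J s -> seg s `<=` J.
Proof.
move=> [Ji J0 _] Js x [/andP[x1 x2]|/andP[x1 x2]].
  by apply: (Ji 0 s) => //; rewrite x1 x2.
by apply: (Ji s 0) => //; rewrite x1 x2.
Qed.

Lemma segP (s x : R) : 0 < s -> seg s x -> 0 <= x <= s.
Proof.
move=> s0 [//|/andP[sx x0]]; have := lt_le_trans s0 (le_trans sx x0).
by rewrite ltxx.
Qed.

Lemma segN (s x : R) : s < 0 -> seg s x -> s <= x <= 0.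
Proof.
move=> s0 [/andP[x0 sx]|//]; have := lt_le_trans s0 (le_trans x0 sx).
by rewrite ltxx.
Qed.

(** A property that holds near t on some curve domain inside each prescribed one
    holds on a right and on a left neighbourhood of t, hence on a full one.
    Only one-sided domains are available at end points and corners. *)
Lemma one_sided_cover (a b t : R) (Good : set R) : a <= t <= b -> Good 0 ->
  (forall J, curve_domain J -> (forall s, J s -> a <= t + s <= b) ->
     exists J', [/\ J' `<=` J, curve_domain J' & exists2 e : R, 0 < e &
       forall s, J' s -> `|s| < e -> Good s]) ->
  exists2 e : R, 0 < e & forall s, a <= t + s <= b -> `|s| < e -> Good s.
Proof.
move=> /andP[at_ tb] G0 H.
have [e1 e10 H1] : exists2 e : R, 0 < e & forall s, t + s <= b -> 0 <= s -> `|s| < e -> Good s.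
  have [bt|tb'] := leP b t.
    exists 1 => // s h s0 _; suff -> : s = 0 by [].
    by apply/eqP; rewrite eq_le s0 andbT -(lerD2l t) addr0 (le_trans h).
  have bt0 : 0 < b - t by rewrite subr_gt0.
  have [|s /(segP bt0)/andP[s0 sb]|J' [J'J cJ' [e e0 He]]] := H (seg (b - t)).
  - by apply: curve_domain_seg; rewrite gt_eqF.
  - by rewrite (le_trans at_) ?lerDl//= -lerBrDl.
  have [_ _ [s0 Js0 s00]] := cJ'.
  have /andP[s0p _] := segP bt0 (J'J _ Js0).
  have {}s0p : 0 < s0 by rewrite lt_neqAle eq_sym s00.
  exists (Num.min e s0) => [|s _ sp]; first by rewrite lt_min e0.
  rewrite lt_min => /andP[se ss0]; apply: He => //; apply: (seg_sub cJ' Js0).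
  by left; rewrite sp /= ltW// (le_lt_trans (ler_norm _)).
have [e2 e20 H2] : exists2 e : R, 0 < e & forall s, a <= t + s -> s <= 0 -> `|s| < e -> Good s.
  have [ta|ta'] := leP t a.
    exists 1 => // s h s0 _; suff -> : s = 0 by [].
    by apply/eqP; rewrite eq_le s0 /= -(lerD2l t) addr0 (le_trans ta).
  have at0 : a - t < 0 by rewrite subr_lt0.
  have [|s /(segN at0)/andP[sa s0]|J' [J'J cJ' [e e0 He]]] := H (seg (a - t)).
  - by apply: curve_domain_seg; rewrite lt_eqF.
  - by rewrite -lerBlDl sa /= (le_trans _ tb)// gerDl.
  have [_ _ [s0 Js0 s00]] := cJ'.
  have /andP[_ s0p] := segN at0 (J'J _ Js0).
  have {}s0p : s0 < 0 by rewrite lt_neqAle s00.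
  exists (Num.min e (- s0)) => [|s _ sp]; first by rewrite lt_min e0 oppr_gt0.
  rewrite lt_min => /andP[se ss0]; apply: He => //; apply: (seg_sub cJ' Js0).
  by right; rewrite sp andbT -lerN2 ltW// (le_lt_trans _ ss0)// -normrN ler_norm.
exists (Num.min e1 e2) => [|s /andP[h1 h2]]; first by rewrite lt_min e10.
rewrite lt_min => /andP[se1 se2]; have [s0|/ltW s0] := leP 0 s; first exact: H1.
exact: H2.
Qed.

Lemma within_ball (J B : set R) : within J (nbhs (0 : R)) B ->
  exists2 e : R, 0 < e & forall s, J s -> `|s| < e -> B s.
Proof.
rewrite /within /= => /nbhs_ballP[e /= e0 He]; exists e => // s Js se.
by apply: (He s) => //; rewrite /ball /= sub0r normrN.
Qed.

Lemma velocity0_estimate (V : normedModType R) (J : set R) (c : R -> V) :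
  has_velocity (M := vmanifold V) J c 0 -> forall e, 0 < e ->
  exists2 d : R, 0 < d & forall s, J s -> `|s| < d -> `|c s - c 0| <= e * `|s|.
Proof.
move=> [_ cv] e e0; move/cvgrPdist_le : cv => /(_ e e0).
rewrite /within /= => /nbhs_ballP[d /= d0 Hd]; exists d => // s Js sd.
have [->|s0] := eqVneq s 0; first by rewrite subrr !normr0 mulr0.
have := Hd s; rewrite /ball /= sub0r normrN => /(_ sd s0 Js).
by rewrite sub0r normrN normrZ normfV ler_pdivrMl ?normr_gt0// mulrC.
Qed.

(** Near a point t the curve stays in the chart at g t, where all its one-sided
    derivatives vanish, so [mean_value_bound] with slope 0 makes it constant
    there; [interval_chain] concludes. *)
Lemma zero_velocity_constant (V : normedModType R) (N : manifold V) (g : R -> N)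
    (a b : R) : a <= b ->
  (forall t J, a <= t <= b -> curve_domain J -> (forall s, J s -> a <= t + s <= b) ->
     exists J', [/\ J' `<=` J, curve_domain J' & has_velocity J' (fun s => g (t + s)) 0]) ->
  g a = g b.
Proof.
move=> ab H; apply: (@interval_chain _ (fun x y => g x = g y)) => //.
  by move=> x y z _ _ -> ->.
move=> t tab.
pose ch := mchart (g t).
have [||e e0 He] := @one_sided_cover a b t (fun s => chart_dom ch (g (t + s))) tab.
- by rewrite addr0; exact: mchart_dom.
- move=> J cJ Jab; have [J' [J'J cJ' vJ']] := H t J tab cJ Jab.
  exists J'; split=> //; apply: within_ball.
  have [cc _] := vJ'; apply: cc; rewrite addr0.
  by apply: open_nbhs_nbhs; split; [exact: chart_dom_open|exact: mchart_dom].
exists e => // x y ax yb /andP[xt ty] tx yt.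
have dom s : x <= s <= y -> chart_dom ch (g s).
  move=> /andP[xs sy]; have := He (s - t); rewrite addrCA subrr addr0; apply.
    by rewrite (le_trans ax)//= (le_trans sy).
  by rewrite ltr_distl (lt_le_trans tx)// (le_lt_trans sy).
have xy := le_trans xt ty.
pose u s := chart_coord ch (g s).
suff uxy : u x = u y.
  rewrite -(chart_coordK (dom x _)) ?lexx ?xy// -(chart_coordK (dom y _)) ?lexx ?xy//.
  by rewrite -!/(u _) uxy.
suff : `|u y - u x| <= 0 * (y - x).
  by rewrite mul0r normr_le0 subr_eq0 => /eqP.
apply: mean_value_bound => // r rxy eps eps0; rewrite add0r.
have /andP[xr ry] := rxy.
have rab : a <= r <= b by rewrite (le_trans ax)//= (le_trans ry).
have [||d d0 Hd] := @one_sided_cover x y r (fun s => `|u (r + s) - u r| <= eps * `|s|) rxy.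
- by rewrite addr0 subrr !normr0 mulr0.
- move=> J cJ Jxy; have [|J' [J'J cJ' vJ']] := H r J rab cJ.
    by move=> s /Jxy/andP[h1 h2]; rewrite (le_trans ax)//= (le_trans h2).
  exists J'; split=> //.
  have mc : mdiff (N := vmanifold V) (chart_coord ch) (g (r + 0)).
    by apply: (msmooth_mdiff (@msmooth_coord _ _ _ _)); rewrite addr0; exact: dom.
  have := velocity_comp mc vJ'; rewrite tmap0 => vu.
  have [d d0 Hd] := velocity0_estimate vu eps0.
  by exists d => // s Js sd; have := Hd s Js sd; rewrite /= addr0.
exists d => // s sxy sd; have := Hd (s - r); rewrite addrCA subrr addr0; exact.
Qed.

End OneSided.

(** * Piecewise smooth curves *)

Section Pieces.
Context {R : realType} {V : normedModType R} {N : manifold V}.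
Implicit Types (l : R -> N) (a b t : R) (s : seq R).

Lemma smooth_within_eq (S : set R) l l' :
  (forall x, S x -> l x = l' x) -> smooth_within S l -> smooth_within S l'.
Proof.
move=> E sl x Sx; have [U [g [Ux sg lg]]] := sl x Sx.
by exists U, g; split=> // y Sy Uy; rewrite -E// lg.
Qed.

(** Piecewise smoothness with the subdivision as a recursive argument and an
    arbitrary starting point, so that curves can be concatenated by induction. *)
Fixpoint smooth_pieces l a s : Prop :=
  if s is x :: s' then [/\ a < x, smooth_within `[a, x]%classic l & smooth_pieces l x s']
  else True.

Lemma smooth_pieces_le l a s : smooth_pieces l a s -> a <= last a s.
Proof.
elim: s a => [|x s IH] a //= [ax _ /IH]; apply: le_trans; exact: ltW.
Qed.

Lemma smooth_pieces_eq l l' a s : (forall t, a <= t <= last a s -> l t = l' t) ->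
  smooth_pieces l a s -> smooth_pieces l' a s.
Proof.
elim: s a => [|x s IH] a //= E [ax sx px]; have xs := smooth_pieces_le px.
split=> //.
  apply: smooth_within_eq sx => t /=; rewrite in_itv /= => /andP[at_ tx].
  by apply: E; rewrite at_ (le_trans tx).
by apply: IH px => t /andP[xt ts]; apply: E; rewrite ts (le_trans (ltW ax)).
Qed.

Lemma smooth_pieces_cat l a s s' : smooth_pieces l a s ->
  smooth_pieces l (last a s) s' -> smooth_pieces l a (s ++ s').
Proof. by elim: s a => [|x s IH] a //= [ax sx px] ps'; split=> //; exact: IH. Qed.

Lemma smooth_piecesP l a s : smooth_pieces l a s <->
  path.path <%R a s /\ forall i, (i < size s)%N ->
    smooth_within `[nth 0 (a :: s) i, nth 0 s i]%classic l.
Proof.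
elim: s a => [|x s IH] a /=; first by split.
split=> [[ax sx /IH[ps sm]]|[/andP[ax ps] sm]].
  by rewrite ax ps; split=> // -[|i] //= /sm.
by split=> //; [exact: (sm 0%N)|apply/IH; split=> // i /(sm i.+1)].
Qed.

Lemma smooth_pieces_right l a s t : smooth_pieces l a s -> a <= t < last a s ->
  exists S c, [/\ smooth_within S l, t < c & forall x, t <= x <= c -> S x].
Proof.
elim: s a => [|x s IH] a /=.
  by move=> _ /andP[h1 h2]; have := le_lt_trans h1 h2; rewrite ltxx.
move=> [ax sx px] /andP[at_ ts]; have [xt|tx] := leP x t; first by apply: (IH x) => //; rewrite xt.
exists `[a, x]%classic, x; split=> // y /andP[ty yx].
by rewrite /= in_itv /= yx (le_trans at_).
Qed.

Lemma smooth_pieces_left l a s t : smooth_pieces l a s -> a < t <= last a s ->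
  exists S c, [/\ smooth_within S l, c < t & forall x, c <= x <= t -> S x].
Proof.
elim: s a => [|x s IH] a /=.
  by move=> _ /andP[h1 h2]; have := lt_le_trans h1 h2; rewrite ltxx.
move=> [ax sx px] /andP[at_ ts]; have [tx|xt] := leP t x; last by apply: (IH x) => //; rewrite xt.
exists `[a, x]%classic, a; split=> // y /andP[ty yx].
by rewrite /= in_itv /= ty (le_trans yx).
Qed.

(** At a corner the two one-sided velocities may differ, so a velocity exists only
    after shrinking the domain J to one side. *)
Lemma smooth_pieces_velocity l a s t (J : set R) : smooth_pieces l a s ->
  curve_domain J -> (forall x, J x -> a <= t + x <= last a s) ->
  exists J', [/\ J' `<=` J, curve_domain J' &
    exists v, has_velocity J' (fun x => l (t + x)) v].
Proof.
move=> ps cJ Jab; have [_ J0 [s0 Js0 s00]] := cJ.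
have /andP[ta tb] : a <= t <= last a s by have := Jab 0 J0; rewrite addr0.
have /andP[sa sb] := Jab _ Js0.
have [s0n|s0p|s0E] := ltgtP s0 0; last by rewrite s0E eqxx in s00.
  have [|S [c [sS ct HS]]] := smooth_pieces_left (t := t) ps.
    by rewrite tb andbT (le_lt_trans sa)// gtrDl.
  pose r := Num.max s0 (c - t).
  have r0 : r < 0 by rewrite gt_max s0n subr_lt0.
  have Jr : J r.
    by apply: (seg_sub cJ Js0); right; rewrite le_max lexx (ltW r0).
  have cr : curve_domain (seg r) by apply: curve_domain_seg; rewrite lt_eqF.
  exists (seg r); split=> //; first exact: seg_sub.
  apply: (velocity_smooth_within sS); first by have [] := cr.
  move=> x /(segN r0)/andP[rx x0]; apply: HS; rewrite gerDl x0 andbT -lerBlDl.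
  by rewrite (le_trans _ rx)// le_max lexx orbT.
have [|S [c [sS ct HS]]] := smooth_pieces_right (t := t) ps.
  by rewrite ta (lt_le_trans _ sb)// ltrDl.
pose r := Num.min s0 (c - t).
have r0 : 0 < r by rewrite lt_min s0p subr_gt0.
have Jr : J r.
  by apply: (seg_sub cJ Js0); left; rewrite ge_min lexx (ltW r0).
have cr : curve_domain (seg r) by apply: curve_domain_seg; rewrite gt_eqF.
exists (seg r); split=> //; first exact: seg_sub.
apply: (velocity_smooth_within sS); first by have [] := cr.
move=> x /(segP r0)/andP[x0 xr]; apply: HS; rewrite lerDl x0 /= -lerBrDl.
by rewrite (le_trans xr)// ge_min lexx orbT.
Qed.

End Pieces.

(** * Uniqueness and existence of horizontal lifts *)

Section HorizontalLifts.
Context {R : realType} {d n k : nat} {G : lieGroup 'rV[R]_d} {M : manifold 'rV[R]_n}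
  {P : principalBundle G M 'rV[R]_k}.
Variable A : connection P.
Implicit Types (l : R -> P) (gam : R -> M).

Definition horizontal_on (a b : R) l : Prop := forall t J Y,
  curve_domain J -> (forall s, J s -> a <= t + s <= b) ->
  has_velocity J (fun s => l (t + s)) Y -> A (l t) Y = 0.

Definition lift_on (a b : R) gam l : Prop :=
  [/\ exists2 s, last a s = b & smooth_pieces l a s,
      forall t, a <= t <= b -> bproj (l t) = gam t & horizontal_on a b l].

(** Two lifts differ by a function g with values in G.  By the Leibniz rule g
    has velocity 0 wherever both lifts have a velocity, since A vanishes on
    both; so g is constant, equal to 1. *)
Lemma lift_unique (a b : R) gam l l' : lift_on a b gam l -> lift_on a b gam l' ->
  l a = l' a -> forall r, a <= r <= b -> l r = l' r.
Proof.
move=> [[s sb ps] pl hl] [[s' sb' ps'] pl' hl'] laE r /andP[ar rb].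
have ab := le_trans ar rb.
have /choice[g Hg] : forall t, exists g, a <= t <= b -> l' t = act (l t) g.
  move=> t; have [tab|ntab] := pselect (a <= t <= b); last by exists (gone G).
  by have [g Hg] := act_transitive (etrans (pl t tab) (esym (pl' t tab))); exists g.
have ga : g a = gone G.
  by apply: (act_free (p := l a)); rewrite act1 -Hg ?lexx.
suff : g a = g r by rewrite ga => gr; rewrite Hg ?ar// -gr act1.
apply: zero_velocity_constant => // t J _ cJ Jar.
have Jab x : J x -> a <= t + x <= b.
  by move=> /Jar/andP[h1 h2]; rewrite h1 (le_trans h2).
have [|J1 [J1J cJ1 [X vX]]] := smooth_pieces_velocity ps cJ (t := t).
  by rewrite sb.
have [|J2 [J2J cJ2 [X' vX']]] := smooth_pieces_velocity ps' cJ1 (t := t).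
  by move=> x /J1J/Jab; rewrite sb'.
have J2ab x : J2 x -> a <= t + x <= b by move=> /J2J/J1J/Jab.
have {}vX := velocity_sub J2J vX.
have J20 : J2 0 by case: cJ2.
have [T vT] := velocity_quotient J20 vX vX' (fun s Js => Hg _ (J2ab s Js)).
exists J2; split=> //; first by move=> x /J2J/J1J.
have [Y vY LY] := velocity_act A vX vT.
have vY' : has_velocity J2 (fun s => l' (t + s)) Y.
  apply: velocity_eq vY => //.
  have : \forall s \near within J2 (nbhs (0 : R)), J2 s by exact: withinT.
  by apply: filterS => x Jx; rewrite -Hg//; exact: J2ab.
have tab : a <= t <= b by have := J2ab 0 J20; rewrite addr0.
have AY := hl' t J2 Y cJ2 J2ab vY'.
have AX := hl t J2 X cJ2 J2ab vX.
move: LY; rewrite !addr0 -Hg// AY AX !tmap0 addr0 => T0.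
by rewrite T0.
Qed.

(** By equivariance of A, right translations preserve horizontality. *)
Lemma lift_act (a b : R) gam l g : lift_on a b gam l ->
  lift_on a b gam (fun t => act (l t) g).
Proof.
move=> [[s sb ps] pl hl].
have sr : msmooth_on setT (fun p : P => act p g).
  apply: (@msmooth_comp _ _ _ _ P (prod_manifold P G) P setT setT
    (fun p => (p, g)) (fun z => act z.1 z.2)) => //.
  - by apply: findim_prod; exact: findim_rV.
  - exact: openT.
  - by apply: msmooth_pair; [exact: msmooth_id|exact: msmooth_cst].
  - exact: act_smooth.
split.
- exists s => //; elim: s a {sb pl hl} ps => [|x s IH] a //= [ax sx px]; split=> //; last exact: IH.
  move=> t St; have [U [f [[oU Ut] sf lf]]] := sx t St.
  exists U, (fun t => act (f t) g); split=> //; last by move=> y Sy Uy; rewrite lf.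
  apply: (@msmooth_comp _ _ _ _ (vmanifold R) P P U setT f (fun p => act p g)) => //.
  exact: findim_rV.
- by move=> t tab; rewrite bproj_act pl.
- move=> t J Y cJ Jab vY.
  have vl := velocity_comp (mdiff_ract (ginv g) _) vY.
  have vl' : has_velocity J (fun s => l (t + s))
      (tmap (fun p : P => act p (ginv g)) (act (l (t + 0)) g) Y).
    apply: velocity_eq vl; first by case: cJ.
    by apply: nearW => x /=; rewrite actK.
  have X0 := hl t J _ cJ Jab vl'.
  have vY' := velocity_comp (mdiff_ract g _) vl'.
  have -> := velocity_unique cJ vY vY'.
  by rewrite addr0 conn_equiv; move: X0; rewrite addr0 => ->; exact: Ad0.
Qed.

(** At the junction b a curve domain J may lie on both sides; a velocity on J
    is also one on either half of J, and one half is enough to compute A. *)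
Lemma lift_glue (a b c : R) gam l l' : lift_on a b gam l -> lift_on b c gam l' ->
  l b = l' b -> lift_on a c gam (fun t => if t <= b then l t else l' t).
Proof.
move=> [[s sb ps] pl hl] [[s' sc ps'] pl' hl'] lb.
set L := (fun t => _).
have Ll t : t <= b -> L t = l t by rewrite /L => ->.
have Ll' t : b <= t -> L t = l' t.
  by rewrite /L => bt; case: ifP => // tb; rewrite (_ : t = b)//; apply/eqP; rewrite eq_le tb.
have ab : a <= b by rewrite -sb; exact: smooth_pieces_le ps.
have bc : b <= c by rewrite -sc; exact: smooth_pieces_le ps'.
split.
- exists (s ++ s'); first by rewrite last_cat sb.
  apply: smooth_pieces_cat.
    by apply: smooth_pieces_eq ps => t; rewrite sb => /andP[_ tb]; rewrite Ll.
  by rewrite sb; apply: smooth_pieces_eq ps' => t /andP[bt _]; rewrite Ll'.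
- move=> t /andP[at_ tc]; have [tb|/ltW bt] := leP t b.
    by rewrite Ll// pl// at_.
  by rewrite Ll'// pl'// bt.
move=> t J Y cJ Jac vY; have [_ J0 [s0 Js0 s00]] := cJ.
have left_case r : r != 0 -> J r -> t <= b -> (forall x, seg r x -> t + x <= b) ->
    A (L t) Y = 0.
  move=> r0 Jr tb rb; have Jr' := seg_sub cJ Jr; have cr := curve_domain_seg r0.
  rewrite Ll//; apply: (hl t (seg r)) => // [x rx|].
    by rewrite rb// andbT; have /andP[] := Jac x (Jr' x rx).
  apply: velocity_eq (velocity_sub Jr' vY); first by case: cr.
  have : \forall x \near within (seg r) (nbhs (0 : R)), seg r x by exact: withinT.
  by apply: filterS => x rx; rewrite Ll// rb.
have right_case r : r != 0 -> J r -> b <= t -> (forall x, seg r x -> b <= t + x) ->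
    A (L t) Y = 0.
  move=> r0 Jr bt rb; have Jr' := seg_sub cJ Jr; have cr := curve_domain_seg r0.
  rewrite Ll'//; apply: (hl' t (seg r)) => // [x rx|].
    by rewrite rb//=; have /andP[] := Jac x (Jr' x rx).
  apply: velocity_eq (velocity_sub Jr' vY); first by case: cr.
  have : \forall x \near within (seg r) (nbhs (0 : R)), seg r x by exact: withinT.
  by apply: filterS => x rx; rewrite Ll'// rb.
have [s0n|s0p|s0E] := ltgtP s0 0; last by rewrite s0E eqxx in s00.
  have [tb|bt] := leP t b.
    apply: (left_case s0) => // x /(segN s0n)/andP[_ x0].
    by rewrite (le_trans _ tb)// gerDl.
  pose r := Num.max s0 (b - t).
  have r0 : r < 0 by rewrite gt_max s0n subr_lt0.
  apply: (right_case r); rewrite ?lt_eqF ?ltW//.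
    by apply: (seg_sub cJ Js0); right; rewrite le_max lexx (ltW r0).
  move=> x /(segN r0)/andP[rx _]; rewrite -lerBlDl (le_trans _ rx)//.
  by rewrite le_max lexx orbT.
have [bt|tb] := leP b t.
  apply: (right_case s0) => // x /(segP s0p)/andP[x0 _].
  by rewrite (le_trans bt)// lerDl.
pose r := Num.min s0 (b - t).
have r0 : 0 < r by rewrite lt_min s0p subr_gt0.
apply: (left_case r); rewrite ?gt_eqF ?ltW//.
  by apply: (seg_sub cJ Js0); left; rewrite ge_min lexx (ltW r0).
move=> x /(segP r0)/andP[_ xr]; rewrite -lerBrDl (le_trans xr)//.
by rewrite ge_min lexx orbT.
Qed.

(** Starting points range over the whole fibre, which makes the property
    transitive in (a, b). *)
Definition liftable gam (a b : R) : Prop := forall p, bproj p = gam a ->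
  exists2 l, l a = p & lift_on a b gam l.

Lemma liftable_trans gam (a b c : R) : a <= b ->
  liftable gam a b -> liftable gam b c -> liftable gam a c.
Proof.
move=> ab Qab Qbc p pa; have [l la Hl] := Qab p pa.
have [|l' lb Hl'] := Qbc (l b); first by have [_ pl _] := Hl; rewrite pl ?lexx ?ab.
exists (fun t => if t <= b then l t else l' t); first by rewrite ab.
by apply: lift_glue.
Qed.

(** One local horizontal lift is enough: its right translates start at all the
    points of the fibre, so no uniform length of existence has to be found. *)
Lemma liftable_local (S : set R) gam t : smooth_within S gam -> S t ->
  exists2 e : R, 0 < e & forall x y, x <= t <= y -> t - e < x -> y < t + e ->
    (forall z, x <= z <= y -> S z) -> liftable gam x y.
Proof.
move=> sg St; have [U [g [[oU Ut] sgU gE]]] := sg t St.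
have [U' [l [oU' U't sl Hl]]] := local_horizontal_lift A oU Ut sgU.
have : nbhs t (U `&` U').
  by apply: open_nbhs_nbhs; split; [exact: openI|split].
move=> /nbhs_ballP[e /= e0 He]; exists e => // x y /andP[xt ty] tx ye Sxy p px.
have UU' z : x <= z <= y -> U z /\ U' z.
  move=> /andP[xz zy]; apply: He; rewrite /ball /= distrC ltr_distl.
  by rewrite (lt_le_trans tx)//= (le_lt_trans zy).
have xy := le_trans xt ty.
have xx : x <= x <= y by rewrite lexx.
have [Ux U'x] := UU' x xx.
have [g0 pE] : exists g0, p = act (l x) g0.
  by apply: act_transitive; have [-> _] := Hl x U'x; rewrite px gE//; exact: Sxy.
pose L (t : vmanifold R) := act (l t) g0.
have sL : msmooth_on U' L.
  apply: (@msmooth_comp _ _ _ _ (vmanifold R) (prod_manifold P G) P U' setT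
    (fun t => (l t, g0)) (fun z => act z.1 z.2)) => //.
  - by apply: findim_prod; exact: findim_rV.
  - by apply: msmooth_pair => //; exact: msmooth_cst.
  - exact: act_smooth.
exists L => //; split.
- exists (if x == y then [::] else [:: y]).
    by case: eqP.
  case: eqP => //= /eqP xny; split=> //; first by rewrite lt_neqAle xny.
  move=> z; rewrite /= in_itv /= => zxy; exists U', L; split=> //.
  by split=> //; have [] := UU' z zxy.
- move=> z zxy; have [Uz U'z] := UU' z zxy; rewrite /L bproj_act.
  by have [-> _] := Hl z U'z; rewrite gE//; exact: Sxy.
- move=> z J Y cJ Jxy vY.
  have zxy : x <= z <= y by have := Jxy 0; rewrite addr0; apply; case: cJ.
  have [_ U'z] := UU' z zxy.
  have -> := velocity_unique cJ vY (velocity_smooth J sL U'z).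
  have := tmap_comp (1 : R) (msmooth_mdiff sl U'z) (mdiff_ract g0 (l z)).
  rewrite (_ : _ \o _ = L)// => ->; rewrite conn_equiv.
  by have [_ ->] := Hl z U'z; exact: Ad0.
Qed.

Lemma liftable_piece gam (a b : R) : a <= b -> smooth_within `[a, b]%classic gam ->
  liftable gam a b.
Proof.
move=> ab sg; apply: interval_chain => //.
  by move=> x y z /andP[_ xy] _; exact: liftable_trans.
move=> t tab; have [|e e0 He] := liftable_local sg (t := t); first by rewrite /= in_itv.
exists e => // x y ax yb xty tx ye; apply: He => // z /andP[xz zy].
by rewrite /= in_itv /= (le_trans ax)//= (le_trans zy).
Qed.

Lemma liftable_pieces gam (a : R) s :
  smooth_pieces gam a s -> liftable gam a (last a s).
Proof.
elim: s a => [|x s IH] a /=.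
  move=> _ p pa; exists (fun=> p) => //; split.
  - by exists [::].
  - by move=> t /andP[ta at_]; rewrite pa; congr gam; apply/eqP; rewrite eq_le ta.
  - move=> t J Y cJ _ vY.
    by rewrite (velocity_unique cJ vY (velocity_cst J p)) linear0.
move=> [ax sx px]; apply: (liftable_trans (ltW ax)); last exact: IH.
exact: liftable_piece (ltW ax) sx.
Qed.

End HorizontalLifts.

(** * The parallel transport isomorphism *)

Section HolonomyCalculus.
Context {R : realType} {d n k : nat} {G : lieGroup 'rV[R]_d} {M : manifold 'rV[R]_n}
  {P : principalBundle G M 'rV[R]_k}.
Variable A : connection P.

Lemma clampE (s : R) : 0 <= s <= 1 -> val (clamp s) = s.
Proof. by move=> /andP[s0 s1]; rewrite /= min_r// max_r. Qed.

Lemma clampK (t : unitI R) : clamp (val t) = t.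
Proof.
case: t => t t01; rewrite /clamp; apply: eq_exist.
by have := clampE t01.
Qed.

Lemma piecewise_smoothP (V : normedModType R) (N : manifold V) (l : unitI R -> N) :
  piecewise_smooth l <-> exists2 s, last 0 s = 1 & smooth_pieces (l \o clamp) 0 s.
Proof.
split=> [[s [ps s1] H]|[s s1 /smooth_piecesP[ps H]]]; exists s => //.
by apply/smooth_piecesP; split.
Qed.

Lemma horizontalP (l : unitI R -> P) :
  horizontal A l <-> horizontal_on A 0 1 (l \o clamp).
Proof.
split=> [H t J Y cJ J01 vY|H t J cJ J01 _ [Y vY <-]].
  have t01 : 0 <= t <= 1 by have := J01 0; rewrite addr0; apply; case: cJ.
  have := H (clamp t) J cJ; rewrite clampE// => /(_ J01 (A (l (clamp t)) Y)).
  by apply; exists Y => //; rewrite addr0.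
by have := H (val t) J Y cJ J01 vY; rewrite /= addr0.
Qed.

Lemma horizontal_liftP (gam : unitI R -> M) (p : P) (l : unitI R -> P) :
  is_horizontal_lift A gam p l <->
  l (clamp 0) = p /\ lift_on A 0 1 (gam \o clamp) (l \o clamp).
Proof.
split=> [[/piecewise_smoothP ps lb l0 /horizontalP hl]|[l0 [ps lb hl]]].
  by split=> //; split=> // t _; exact: lb.
split=> //; [exact/piecewise_smoothP| |exact/horizontalP].
by move=> t; have := lb (val t) (valP t); rewrite /= clampK.
Qed.

Lemma horizontal_lift_spec (gam : unitI R -> M) (p : P) : piecewise_smooth gam ->
  bproj p = gam (clamp 0) -> is_horizontal_lift A gam p (horizontal_lift A gam p).
Proof.
move=> /piecewise_smoothP[s s1 ps] pg.
have [l l0 Hl] := liftable_pieces A ps pg; rewrite s1 in Hl.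
suff : is_horizontal_lift A gam p (fun t => l (val t)).
  move=> H; apply: (@xgetPex _ (fun=> p) (is_horizontal_lift A gam p)).
  by exists (fun t => l (val t)).
apply/horizontal_liftP; split; first by rewrite clampE ?lexx ?ler01.
have [[s' s1' ps'] lb hl] := Hl.
have E t : 0 <= t <= 1 -> l t = l (val (clamp t)) by move=> t01; rewrite clampE.
split.
- by exists s' => //; apply: smooth_pieces_eq ps' => t; rewrite s1'; exact: E.
- by move=> t t01; rewrite /= -E//; exact: lb.
- move=> t J Y cJ J01 vY.
  have t01 : 0 <= t <= 1 by have := J01 0; rewrite addr0; apply; case: cJ.
  rewrite /= -E//; apply: (hl t J) => //.
  apply: velocity_eq vY; first by case: cJ.
  have : \forall x \near within J (nbhs (0 : R)), J x by exact: withinT.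
  by apply: filterS => x Jx; rewrite /= -E//; exact: J01.
Qed.

Lemma horizontal_lift_proj (gam : unitI R -> M) (p : P) t : piecewise_smooth gam ->
  bproj p = gam (clamp 0) -> bproj (horizontal_lift A gam p t) = gam t.
Proof. by move=> sg pg; have [_ ->] := horizontal_lift_spec sg pg. Qed.

Lemma horizontal_lift_act (gam : unitI R -> M) (p : P) (g : G) t : piecewise_smooth gam ->
  bproj p = gam (clamp 0) ->
  horizontal_lift A gam (act p g) t = act (horizontal_lift A gam p t) g.
Proof.
move=> sg pg; have pg' : bproj (act p g) = gam (clamp 0) by rewrite bproj_act.
have /horizontal_liftP[l0 Hl] := horizontal_lift_spec sg pg.
have /horizontal_liftP[l0' Hl'] := horizontal_lift_spec sg pg'.
have := lift_unique Hl' (lift_act g Hl); rewrite /= l0 l0' => /(_ erefl _ (valP t)).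
by rewrite clampK.
Qed.

Lemma hol_spec (gam : unitI R -> M) t (p q : P) : piecewise_smooth gam ->
  bproj p = gam (clamp 0) -> bproj q = gam t ->
  horizontal_lift A gam p t = act q (hol A gam t p q).
Proof.
move=> sg pg qg; have [h Hh] : exists h, horizontal_lift A gam p t = act q h.
  by apply: act_transitive; rewrite horizontal_lift_proj.
by apply: (@xgetPex _ (gone G) [set h | _ = act q h]); exists h.
Qed.

Section ParallelTransportMap.
Variable E : set (unitI R -> M).
Hypothesis E_smooth : forall gam, E gam -> piecewise_smooth gam.

Lemma pb_ext (B : Type) (f : B -> M) (w w' : pb P f) :
  pb_base w = pb_base w' -> pb_point w = pb_point w' -> w = w'.
Proof.
case: w w' => [b p e] [b' p' e'] /= bb pp; subst b' p'.
by rewrite (Prop_irrelevance e e').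
Qed.

Let path_smooth (b : EI E) : piecewise_smooth (sval b.1).
Proof. by apply: E_smooth; exact: svalP. Qed.

(** The auxiliary fibre point in the definition of Phi cancels. *)
Lemma Phi_point (w : pb P (ev0 (E := E))) :
  pb_point (Phi A w) = horizontal_lift A (sval (pb_base w).1) (pb_point w) (pb_base w).2.
Proof.
rewrite /Phi /=; symmetry; apply: hol_spec; first exact: path_smooth.
  exact: (pb_eq w).
exact: fibre_pointP.
Qed.

(** Lifts from two points of a fibre are right translates of each other, and
    the action is free. *)
Lemma Phi_inj : injective (@Phi _ _ _ _ _ _ _ A E).
Proof.
move=> w w' ww; have bb : pb_base w = pb_base w' by exact: (congr1 (@pb_base _ _ _ _ _ _ _ _ _) ww).
apply: pb_ext => //.
have := congr1 (@pb_point _ _ _ _ _ _ _ _ _) ww; rewrite !Phi_point -bb.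
have w0 := pb_eq w; have w0' := pb_eq w'; rewrite -bb in w0'.
have [g ->] := act_transitive (etrans w0 (esym w0')).
rewrite horizontal_lift_act; [|exact: path_smooth|exact: w0].
by rewrite -{1}[horizontal_lift _ _ _ _]act1 => /act_free <-; rewrite act1.
Qed.

Variable z : fibre_prod P (ev0 (E := E)) (ev (E := E)).
Let p := pb_point (fp1 z).
Let q := pb_point (fp2 z).

(** The lift from p passes through q h; the next two lemmas read off
    Phi . Phi^-1 : (p, q) |-> (q h, p h^-1) from this. *)
Lemma lift_Hol :
  horizontal_lift A (sval (pb_base (fp1 z)).1) p (pb_base (fp1 z)).2 = act q (Hol A z).
Proof.
apply: hol_spec; first exact: path_smooth.
  exact: (pb_eq (fp1 z)).
by rewrite /q (pb_eq (fp2 z)) -(fp_eq z).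
Qed.

Lemma Phi_odot_inv1 : pb_point (fp1 (Phi_odot_inv A z)) = act q (Hol A z).
Proof. by rewrite [LHS]Phi_point; exact: lift_Hol. Qed.

Lemma Phi_odot_inv2 : pb_point (fp2 (Phi_odot_inv A z)) = act p (ginv (Hol A z)).
Proof.
have w0P : bproj (act p (ginv (Hol A z))) = ev0 (pb_base (fp1 z)).
  by rewrite bproj_act; exact: (pb_eq (fp1 z)).
pose w0 := Pb w0P.
have Hw0 : Phi A w0 = fp2 z.
  apply: pb_ext; first exact: (fp_eq z).
  rewrite Phi_point /= horizontal_lift_act; [|exact: path_smooth|exact: (pb_eq (fp1 z))].
  by rewrite lift_Hol actK.
rewrite /Phi_odot_inv /= /pb_inv; case: pselect => [ex|]; last by case; exists w0.
by case: cid => w /= Hw; rewrite (Phi_inj (etrans Hw (esym Hw0))).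
Qed.

End ParallelTransportMap.

Lemma intertwinesE (E : set (unitI R -> M)) (J : set R)
    (c : R -> fibre_prod P (ev0 (E := E)) (ev (E := E))) :
  (forall gam, E gam -> piecewise_smooth gam) ->
  pullback_form (@Phi_odot_inv _ _ _ _ _ _ _ A E)
    (fibre_prod_form (pb_conn A _) (pb_conn A _)) J c =
  [set xi | conn_form A J (fun s => act (pb_point (fp2 (c s))) (Hol A (c s))) xi.1 /\
            conn_form A J (fun s => act (pb_point (fp1 (c s))) (ginv (Hol A (c s)))) xi.2].
Proof.
move=> Es; rewrite /pullback_form /fibre_prod_form /pb_conn /pullback_form.
rewrite (_ : (fun s => act (pb_point (fp2 (c s))) _) =
  @pb_point _ _ _ _ _ _ _ _ _ \o
    (@fp1 _ _ _ _ _ _ _ _ _ _ \o (@Phi_odot_inv _ _ _ _ _ _ _ A E \o c))).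
  rewrite (_ : (fun s => act (pb_point (fp1 (c s))) _) =
    @pb_point _ _ _ _ _ _ _ _ _ \o
      (@fp2 _ _ _ _ _ _ _ _ _ _ \o (@Phi_odot_inv _ _ _ _ _ _ _ A E \o c))) //.
  by apply/funext => s; rewrite -[LHS](Phi_odot_inv2 Es).
by apply/funext => s; rewrite -[LHS](Phi_odot_inv1 Es).
Qed.

End HolonomyCalculus.

Theorem corollary7p10 (R : realType) (d n k : nat)
    (G : lieGroup 'rV[R]_d) (M : manifold 'rV[R]_n)
    (M_connected : connected [set: M]) (M_paracompact : paracompact M)
    (P : principalBundle G M 'rV[R]_k) (A : connection P)
    (E : set (unitI R -> M))
    (E_paths_or_loops : E = loopSpace M \/ E = pathSpace M) :
  intertwines_connections A E <-> horizontality_equation A E.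
Proof.
have Es gam : E gam -> piecewise_smooth gam.
  by case: E_paths_or_loops => -> // [].
split=> H J c cJ sc.
  move=> p q h Xp Xq vp vq.
  have J0 : J 0 by case: cJ.
  (* The right-hand side has a value on c, so the pulled-back form has one too:
     this is what makes q h, hence h, differentiable along c. *)
  have := H J c cJ sc; rewrite (intertwinesE _ _ _ Es).
  move=> /seteqP[_ /(_ (A (p 0) Xp, A (q 0) Xq))].
  case; first by split; [exists Xp|exists Xq].
  move=> [Y vY /= AY] _.
  have [T vT] := velocity_quotient J0 vq vY (fun s _ => erefl).
  exists T => //.
  have [Y' vY' LY] := velocity_act A vq vT.
  rewrite -/h (velocity_unique cJ vY' vY) AY in LY.
  by rewrite -LY subrr.
rewrite (intertwinesE _ _ _ Es).
pose p s := pb_point (fp1 (c s)); pose q s := pb_point (fp2 (c s)); pose h s := Hol A (c s).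
have J0 : J 0 by case: cJ.
have [Xp vp] : exists v, has_velocity J p v.
  have [[_ sp] _] := sc.
  have [|Xp] := velocity_smooth_within sp J0 (t := 0); first by move=> s; rewrite add0r.
  by exists Xp; rewrite (_ : p = (fun s => p (0 + s)))//; apply/funext => s; rewrite add0r.
have [Xq vq] : exists v, has_velocity J q v.
  have [_ [_ sq]] := sc.
  have [|Xq] := velocity_smooth_within sq J0 (t := 0); first by move=> s; rewrite add0r.
  by exists Xq; rewrite (_ : q = (fun s => q (0 + s)))//; apply/funext => s; rewrite add0r.
have [T vT eqT] := H J c cJ sc Xp Xq vp vq.
have [Y vY LY] := velocity_act A vq vT.
have AY : A (act (q 0) (h 0)) Y = A (p 0) Xp.
  apply: (@tmap_lmul_inj _ _ _ (h 0)); rewrite LY; apply/eqP.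
  by rewrite -subr_eq0; apply/eqP; exact: eqT.
have vT' := velocity_comp (mdiff_ginv (h 0)) vT.
have [X' vX' _] := velocity_act A vp vT'.
(* The second component follows by writing p = (p h^-1) h. *)
have AX' : A (act (p 0) (ginv (h 0))) X' = A (q 0) Xq.
  have [Z vZ LZ] := velocity_act A vX' vT.
  have vp' : has_velocity J p Z.
    apply: velocity_eq vZ => //; apply: nearW => s /=.
    by rewrite actVK.
  have ZX := velocity_unique cJ vp' vp.
  apply: (@tmap_rmul_inj _ _ _ (h 0)); apply: (addrI T).
  rewrite -LZ ZX actVK; apply/eqP.
  by rewrite eq_sym -subr_eq0; apply/eqP; exact: eqT.
apply/seteqP; split=> -[x y] /=.
  move=> [[Y' vY' /= <-] [X'' vX'' /= <-]].
  split.
    by exists Xp => //=; rewrite (velocity_unique cJ vY' vY) -AY.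
  by exists Xq => //=; rewrite (velocity_unique cJ vX'' vX') -AX'.
move=> [[Y' vY' /= <-] [X'' vX'' /= <-]].
split.
  by exists Y => //=; rewrite (velocity_unique cJ vY' vp) -AY.
by exists X' => //=; rewrite (velocity_unique cJ vX'' vq) -AX'.
Qed.
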